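(* Let $\{(E_h^n,B_h^n)\}_{n=0}^{N_t}\subset\mathcal N_h^0\times\mathcal{RT}_h$ solve the fully discrete system: for $n=0,\dots,N_t-1$ and all $(\psi_h,\phi_h)\in\mathcal N_h^0\times\mathcal{RT}_h$, $$(\varepsilon\,\delta_tE_h^{n+1},\psi_h)+(\sigma E_h^{n+\frac12},\psi_h)-(\mu^{-1}B_h^{n+\frac12},\operatorname{curl}\psi_h)=(f^{n+\frac12},\psi_h),\qquad(\delta_tB_h^{n+1},\phi_h)+(\operatorname{curl}E_h^{n+\frac12},\phi_h)=0.$$ Then the discrete divergence evolves in $\mathcal Q_h$ according to $$\delta_t(\operatorname{div}_hB_h^{n+1})+\operatorname{div}_h(\operatorname{curl}E_h^{n+\frac12})=0\quad\text{in }\mathcal Q_h,$$ which implies $\delta_t(\operatorname{div}_hB_h^{n+1})=0$ in $\mathcal Q_h$. In particular, if $\operatorname{div}_hB_h^0=0$ in $\mathcal Q_h$, then $\operatorname{div}_hB_h^n=0$ in $\mathcal Q_h$ for all $n$.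
   Context: $\Omega\subset\mathbb R^3$ is a bounded Lipschitz domain with outward unit normal $\nu$, and $T>0$. $(\cdot,\cdot)$ is the $L^2(\Omega)$ inner product (scalar or vector). The tensors $\varepsilon,\mu,\sigma\in L^\infty(\Omega;\mathbb R^{3\times3})$ are symmetric; $\varepsilon,\mu$ are uniformly positive definite a.e. in $\Omega$ and $\sigma$ is positive semidefinite; $f\in L^2(0,T;L^2(\Omega)^3)$. Discrete spaces: $\{\mathcal T_h\}_h$ is a family of shape-regular meshes of $\Omega$, $k\ge0$ fixed. $\mathcal N_h=\{v_h\in H(\operatorname{curl};\Omega): v_h|_K\in\mathcal N_k(K)\ \forall K\in\mathcal T_h\}$ with $\mathcal N_k(K)$ the local Nédélec space of the first kind of degree $k$ (convention: $\mathbb P_k(K)^3\subset\mathcal N_k(K)$); $\mathcal N_h^0=\mathcal N_h\cap H_0(\operatorname{curl};\Omega)$ where $H_0(\operatorname{curl};\Omega)=\{v\in H(\operatorname{curl};\Omega):v\times\nu=0\text{ on }\partial\Omega\}$. $\mathcal{RT}_h=\{w_h\in H(\operatorname{div};\Omega): w_h|_K\in\mathcal{RT}_k(K)\ \forall K\}$ with $\mathcal{RT}_k(K)$ the local Raviart--Thomas space of degree $k$. $\mathcal Q_h=\{q_h\in L^2(\Omega): q_h|_K\in\mathbb P_k(K)\ \forall K\}$. They satisfy $\operatorname{curl}\mathcal N_h^0\subset\mathcal{RT}_h$ and $\operatorname{div}\mathcal{RT}_h\subset\mathcal Q_h$. $\operatorname{div}_h:=\operatorname{div}|_{\mathcal{RT}_h}:\mathcal{RT}_h\to\mathcal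 Q_h$. Time grid: $\Delta t=T/N_t$, $t^n=n\Delta t$; $\delta_tg^{n+1}=(g^{n+1}-g^n)/\Delta t$, $g^{n+\frac12}=\tfrac12(g^{n+1}+g^n)$ for $g=E_h,B_h$, while $f^{n+\frac12}=\frac1{\Delta t}\int_{t^n}^{t^{n+1}}f(s)\,ds$. *)

(* Defs.v *)
From HB Require Import structures.
From mathcomp Require Import all_boot all_order all_algebra.
From mathcomp Require Import all_classical all_reals all_analysis.
Set Implicit Arguments.
Unset Strict Implicit.
Unset Printing Implicit Defensive.
Import Order.TTheory GRing.Theory Num.Theory numFieldNormedType.Exports.
Local Open Scope classical_set_scope.
Local Open Scope ring_scope.

(* Points of R^3 are triples, so that the topology and the product Lebesgue
   measure are the library's; values of vector fields are columns 'cV[R]_3. *)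
Notation pt3 R := (R * R * R)%type.

Section Maxwell.
Context {R : realType}.
Implicit Types (Omega K : set (pt3 R)) (T : set (set (pt3 R))).
Implicit Types (u d : pt3 R -> R) (v w : pt3 R -> 'cV[R]_3).

Local Notation leb := (@lebesgue_measure R).

Definition leb3 : {measure set (measurableTypeR R * measurableTypeR R *
    measurableTypeR R)%type -> \bar R} := ((leb \x leb) \x leb)%E.

Definition vec (x : pt3 R) : 'cV[R]_3 :=
  \col_i tnth [tuple x.1.1; x.1.2; x.2] i.

Definition pt (a : 'cV[R]_3) : pt3 R := (a 0 0, a 1 0, a 2 0).

Definition dot (a b : 'cV[R]_3) : R := \sum_i a i 0 * b i 0.

Definition enorm (a : 'cV[R]_3) : R := Num.sqrt (dot a a).

Definition comp v (i : 'I_3) : pt3 R -> R := fun x => v x i 0.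

Definition mulfield (A : pt3 R -> 'M[R]_3) v : pt3 R -> 'cV[R]_3 :=
  fun x => A x *m v x.

Definition basis (i : 'I_3) : pt3 R := pt (delta_mx i 0).

Definition partial (i : 'I_3) u : pt3 R -> R := fun x => 'D_(basis i) u x.

Definition grad u : pt3 R -> 'cV[R]_3 := fun x => \col_i partial i u x.

(* The indices i + 1 and i + 2 are computed modulo 3 in 'I_3. *)
Definition curl v : pt3 R -> 'cV[R]_3 := fun x =>
  \col_i (partial (i + 1) (comp v (i + 2)) x
          - partial (i + 2) (comp v (i + 1)) x).

Definition smooth u := forall s : seq 'I_3,
  continuous (foldr partial u s) /\
  forall i x, derivable (foldr partial u s) x (basis i).

Definition test_fun Omega u :=
  smooth u /\
  exists C : set (pt3 R),
    [/\ compact C, C `<=` Omega & forall x, ~ C x -> u x = 0].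

Definition test_field Omega v := forall i, test_fun Omega (comp v i).

(* Elements of the Lebesgue and Sobolev spaces are represented by functions on
    the whole of R^3, of which only the values a.e. in Omega matter. *)

Definition L2 Omega u := (u \_ Omega) \in Lfun leb3 2%:E.

Definition L2v Omega v := forall i, L2 Omega (comp v i).

Definition Linf Omega u := (u \_ Omega) \in Lfun leb3 +oo%E.

Definition ip Omega v w : R := \int[leb3]_(x in Omega) dot (v x) (w x).

Definition is_weak_partial Omega (i : 'I_3) u d :=
  forall phi, test_fun Omega phi ->
    \int[leb3]_(x in Omega) (d x * phi x) =
    - \int[leb3]_(x in Omega) (u x * partial i phi x).

Definition is_weak_curl Omega v w :=
  forall phi, test_field Omega phi -> ip Omega w phi = ip Omega v (curl phi).

Definition is_weak_div Omega w d :=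
  forall phi, test_fun Omega phi ->
    \int[leb3]_(x in Omega) (d x * phi x) = - ip Omega w (grad phi).

Definition H1 Omega u :=
  L2 Omega u /\ forall i, exists d, L2 Omega d /\ is_weak_partial Omega i u d.

Definition Hcurl Omega v :=
  L2v Omega v /\ exists w, L2v Omega w /\ is_weak_curl Omega v w.

Definition Hdiv Omega w :=
  L2v Omega w /\ exists d, L2 Omega d /\ is_weak_div Omega w d.

(* Representatives of the weak curl and divergence, meaningful on Hcurl and
   Hdiv only, where they are determined up to a null set. *)
Definition wcurl Omega v : pt3 R -> 'cV[R]_3 :=
  get [set w | L2v Omega w /\ is_weak_curl Omega v w].

Definition wdiv Omega w : pt3 R -> R :=
  get [set d | L2 Omega d /\ is_weak_div Omega w d].

(* The trace v x nu of v in Hcurl, as the functional on traces of H^1 fields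
   w given by Green's formula: for smooth v and w this is the boundary
   integral of (v x nu) . w. *)
Definition tangential_trace Omega v w : R :=
  ip Omega v (wcurl Omega w) - ip Omega (wcurl Omega v) w.

Definition H0curl Omega v :=
  Hcurl Omega v /\
  forall w, (forall i, H1 Omega (comp w i)) -> tangential_trace Omega v w = 0.

(* Near each boundary point, Omega is the strict epigraph of a Lipschitz
   function in the orthonormal coordinates given by Q. *)
Definition bounded_lipschitz_domain Omega :=
  [/\ Omega !=set0, open Omega, connected Omega, bounded_set Omega &
    forall x, (closure Omega `\` Omega) x ->
      exists (Q : 'M[R]_3) (g : R -> R -> R) (L : R),
        [/\ Q^T *m Q = 1%:M,
          forall a b a' b', `|g a b - g a' b'| <= L * (`|a - a'| + `|b - b'|) &
          \forall y \near x,
            Omega y <-> let z := Q *m vec y in g (z 0 0) (z 1 0) < z 2 0]].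

Definition Linf_tensor Omega (A : pt3 R -> 'M[R]_3) :=
  forall i j, Linf Omega (fun x => A x i j).

Definition symmetric_tensor Omega (A : pt3 R -> 'M[R]_3) :=
  {ae leb3, forall x, Omega x -> (A x)^T = A x}.

Definition uniformly_posdef Omega (A : pt3 R -> 'M[R]_3) :=
  exists2 c : R, 0 < c &
    {ae leb3, forall x, Omega x ->
       forall a : 'cV[R]_3, c * dot a a <= dot (A x *m a) a}.

Definition possemidef Omega (A : pt3 R -> 'M[R]_3) :=
  {ae leb3, forall x, Omega x -> forall a : 'cV[R]_3, 0 <= dot (A x *m a) a}.

(* L^2(0,T; L^2(Omega)^3) is identified with L^2 of the space-time cylinder. *)
Definition L2_time_space (Tf : R) Omega (f : R -> pt3 R -> 'cV[R]_3) :=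
  forall i, ((fun z : pt3 R * R => f z.2 z.1 i 0) \_ (Omega `*` `]0, Tf[))
    \in Lfun (leb3 \x leb)%E 2%:E.

(* Mesh elements are open tetrahedra; a i are the vertices. *)

Definition affinely_independent (a : 'I_4 -> 'cV[R]_3) :=
  forall t : 'I_4 -> R, \sum_i t i = 0 -> \sum_i t i *: a i = 0 ->
    forall i, t i = 0.

Definition open_tetra (a : 'I_4 -> 'cV[R]_3) : set (pt3 R) :=
  [set x | exists t : 'I_4 -> R,
    [/\ forall i, 0 < t i, \sum_i t i = 1 & vec x = \sum_i t i *: a i]].

(* convex hull of the vertices a i, i in J *)
Definition face (a : 'I_4 -> 'cV[R]_3) (J : set 'I_4) : set (pt3 R) :=
  [set x | exists t : 'I_4 -> R,
    [/\ forall i, 0 <= t i, forall i, ~ J i -> t i = 0, \sum_i t i = 1 &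
        vec x = \sum_i t i *: a i]].

Definition tetra_mesh Omega T :=
  [/\ finite_set T,
    forall K, T K -> exists2 a, affinely_independent a & K = open_tetra a,
    forall K, T K -> K `<=` Omega,
    closure Omega = \bigcup_(K in T) closure K &
    forall a b, affinely_independent a -> affinely_independent b ->
      T (open_tetra a) -> T (open_tetra b) ->
      face a setT `&` face b setT = face a [set i | exists j, a i = b j]].

Definition diameter K : R :=
  sup [set r | exists x y, [/\ K x, K y & r = enorm (vec x - vec y)]].

Definition inradius K : R :=
  sup [set r | 0 < r /\
    exists c, [set x | enorm (vec x - vec c) < r] `<=` K].

Definition shape_regular (H : Type) (Th : H -> set (set (pt3 R))) :=
  exists kappa : R, forall h K, Th h K -> diameter K <= kappa * inradius K.

(* Linear combinations of the monomials whose total degree satisfies P; as each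
   exponent is bounded by k, P is to be used with total degrees at most k. *)
Definition poly_of_degree (P : pred nat) (k : nat) u :=
  exists c : nat -> nat -> nat -> R, forall x,
    u x = \sum_(i < k.+1) \sum_(j < k.+1) \sum_(l < k.+1 | P (i + j + l)%N)
            c i j l * (x.1.1 ^+ i * x.1.2 ^+ j * x.2 ^+ l).

Definition Pk (k : nat) u := poly_of_degree (fun m => (m <= k)%N) k u.

Definition Pk_homog (k : nat) u := poly_of_degree (fun m => m == k) k u.

Definition nedelec (k : nat) v :=
  exists p q : pt3 R -> 'cV[R]_3,
    [/\ forall i, Pk k (comp p i), forall i, Pk_homog k.+1 (comp q i),
        forall x, dot (vec x) (q x) = 0 & forall x, v x = p x + q x].

Definition raviart_thomas (k : nat) w :=
  exists (p : pt3 R -> 'cV[R]_3) (q : pt3 R -> R),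
    [/\ forall i, Pk k (comp p i), Pk_homog k q &
        forall x, w x = p x + q x *: vec x].

Definition Nh Omega (k : nat) T v :=
  Hcurl Omega v /\
  forall K, T K -> exists2 p, nedelec k p &
    {ae leb3, forall x, K x -> v x = p x}.

Definition Nh0 Omega (k : nat) T v := Nh Omega k T v /\ H0curl Omega v.

Definition RTh Omega (k : nat) T w :=
  Hdiv Omega w /\
  forall K, T K -> exists2 p, raviart_thomas k p &
    {ae leb3, forall x, K x -> w x = p x}.

Definition Qh Omega (k : nat) T u :=
  L2 Omega u /\
  forall K, T K -> exists2 p, Pk k p & {ae leb3, forall x, K x -> u x = p x}.

(* Equality in Q_h: both sides belong to Q_h and agree a.e. *)
Definition eq_Qh Omega (k : nat) T u d :=
  [/\ Qh Omega k T u, Qh Omega k T d &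
      {ae leb3, forall x, Omega x -> u x = d x}].

(* delta_t at n is the difference quotient usually indexed by n + 1, and
   midpoint and time_average at n are the values indexed by n + 1/2. *)
Definition delta_t (V : lmodType R) (dt : R) (g : nat -> pt3 R -> V) (n : nat) :
  pt3 R -> V := fun x => dt^-1 *: (g n.+1 x - g n x).

Definition midpoint (g : nat -> pt3 R -> 'cV[R]_3) (n : nat) :
  pt3 R -> 'cV[R]_3 := fun x => 2^-1 *: (g n.+1 x + g n x).

Definition time_average (dt : R) (f : R -> pt3 R -> 'cV[R]_3) (n : nat) :
  pt3 R -> 'cV[R]_3 := fun x =>
  \col_i (dt^-1 * \int[leb]_(s in `[n%:R * dt, n.+1%:R * dt]) f s x i 0).

Definition discrete_solution Omega (k : nat) T
    (eps mu sigma : pt3 R -> 'M[R]_3) (f : R -> pt3 R -> 'cV[R]_3)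
    (dt : R) (Nt : nat) (E B : nat -> pt3 R -> 'cV[R]_3) :=
  [/\ forall n, (n <= Nt)%N -> Nh0 Omega k T (E n),
    forall n, (n <= Nt)%N -> RTh Omega k T (B n) &
    forall n, (n < Nt)%N ->
      (forall psi, Nh0 Omega k T psi ->
        ip Omega (mulfield eps (delta_t dt E n)) psi
        + ip Omega (mulfield sigma (midpoint E n)) psi
        - ip Omega (mulfield (fun x => invmx (mu x)) (midpoint B n))
            (wcurl Omega psi)
        = ip Omega (time_average dt f n) psi) /\
      (forall phi, RTh Omega k T phi ->
        ip Omega (delta_t dt B n) phi
        + ip Omega (wcurl Omega (midpoint E n)) phi = 0)].

End Maxwell.

(* Main.v *)
Require Import Defs.
From HB Require Import structures.
From mathcomp Require Import all_boot all_order all_algebra.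
From mathcomp Require Import all_classical all_reals all_analysis.
From mathcomp Require Import measurable_realfun ring lra.
Set Implicit Arguments.
Unset Strict Implicit.
Unset Printing Implicit Defensive.
Import Order.TTheory GRing.Theory Num.Theory numFieldNormedType.Exports.
Local Open Scope classical_set_scope.
Local Open Scope ring_scope.

(* On each tetrahedron the weak curl w of E^{n+1/2} is the classical curl of the
   Nedelec polynomial, so its components lie in P_k and w is in RT_h; moreover
   div w = 0 weakly, since curl grad = 0.  Hence phi = delta_t B^{n+1} + w is an
   admissible test function in the second equation, which then says that
   (phi, phi) = 0.  So delta_t B^{n+1} = - w a.e. in Omega, and both have zero
   divergence.  That weak curls and divergences are determined a.e. is the
   fundamental lemma of the calculus of variations, proved by exhausting boxes
   with smooth bumps. *)

(** * Topology and measure on R^3 *)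

(** The second equation is tested only against [RTh], so it gives a pointwise identity only once its
    own residual is known to lie in [RTh]; this is what forces the local computation of the curl.
    That computation avoids traces on faces: by [Hcurl] the weak curl is already a single L^2 field
    on [Omega], so on each open tetrahedron it only has to be identified against test functions
    compactly supported there, and integration by parts reduces to the vanishing of the integral of
    a compactly supported derivative. Membership of w in H(div) is likewise obtained globally, with
    zero as a weak divergence, rather than by matching normal components across faces. [wcurl] and
    [wdiv] are arbitrary choices of representatives, hence not literally linear; linearity is proved
    for the relations [is_weak_curl] and [is_weak_div], and the choice is undone by uniqueness a.e.
    Membership in [Qh] is then free: the functions concerned vanish a.e., so the zero polynomial
    represents them on each element. *)

Notation mpt3 R := (measurableTypeR R * measurableTypeR R * measurableTypeR R)%type.

(** Indexing coordinates by ['I_3] treats the three directions at once; [pcoordE] returns to the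
    projections of nested pairs. *)
Definition pcoord (R : realType) (i : 'I_3) (x : pt3 R) : R := vec x i 0.

Lemma ord3_ind (P : 'I_3 -> Prop) : P 0 -> P 1 -> P 2 -> forall i, P i.
Proof.
move=> P0 P1 P2 [[|[|[|//]]] Hi].
- by rewrite (_ : Ordinal Hi = 0) //; apply: val_inj.
- by rewrite (_ : Ordinal Hi = 1) //; apply: val_inj.
- by rewrite (_ : Ordinal Hi = 2) //; apply: val_inj.
Qed.

Lemma ord3_neq : (((0 == 1 :> 'I_3) = false)%R * ((0 == 2 :> 'I_3) = false)%R *
  ((1 == 0 :> 'I_3) = false)%R * ((1 == 2 :> 'I_3) = false)%R *
  ((2 == 0 :> 'I_3) = false)%R * ((2 == 1 :> 'I_3) = false)%R)%type.
Proof. by []. Qed.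

Section R3.
Context {R : realType}.
Implicit Types (U : set (pt3 R)) (x a b : pt3 R).

Lemma pcoord0 x : pcoord 0 x = x.1.1.
Proof. by rewrite /pcoord /vec mxE. Qed.
Lemma pcoord1 x : pcoord 1 x = x.1.2.
Proof. by rewrite /pcoord /vec mxE. Qed.
Lemma pcoord2 x : pcoord 2 x = x.2.
Proof. by rewrite /pcoord /vec mxE. Qed.

Definition pcoordE := (pcoord0, pcoord1, pcoord2).

Lemma pcoord_funE : (pcoord 0 = (fun x => x.1.1) :> (pt3 R -> R)) *
  (pcoord 1 = (fun x => x.1.2) :> (pt3 R -> R)) *
  (pcoord 2 = (fun x => x.2) :> (pt3 R -> R)).
Proof. by split; [split|]; apply/funext => x; rewrite pcoordE. Qed.

Lemma pcoord_inj x y : (forall i, pcoord i x = pcoord i y) -> x = y.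
Proof.
move: x y => [[a b] c] [[a' b'] c'] H.
by have := (H 0, H 1, H 2); rewrite !pcoordE /= => -[[-> ->] ->].
Qed.

Definition mkpt (c : 'I_3 -> R) : pt3 R := (c 0, c 1, c 2).

Lemma pcoord_mkpt c i : pcoord i (mkpt c) = c i.
Proof. by elim/ord3_ind: i; rewrite pcoordE. Qed.

Lemma pcoord_continuous i : continuous (@pcoord R i).
Proof.
have c11 : continuous (fun x : pt3 R => x.1.1).
  by move=> x; apply: (@continuous_comp _ _ _ fst fst); exact: cvg_fst.
have c12 : continuous (fun x : pt3 R => x.1.2).
  by move=> x; apply: (@continuous_comp _ _ _ fst snd); [exact: cvg_fst|exact: cvg_snd].
have c2 : continuous (fun x : pt3 R => x.2) by move=> x; exact: cvg_snd.
by elim/ord3_ind: i; rewrite pcoord_funE.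
Qed.

Lemma measurable_pcoord i : measurable_fun [set: mpt3 R] (pcoord i : mpt3 R -> measurableTypeR R).
Proof.
have m11 : measurable_fun [set: mpt3 R] (fun x : mpt3 R => x.1.1).
  by apply: measurableT_comp.
have m12 : measurable_fun [set: mpt3 R] (fun x : mpt3 R => x.1.2).
  by apply: measurableT_comp.
have m2 : measurable_fun [set: mpt3 R] (fun x : mpt3 R => x.2) by exact: measurable_snd.
by elim/ord3_ind: i; rewrite pcoord_funE.
Qed.

Definition box a b : set (pt3 R) :=
  [set x | forall i, pcoord i a < pcoord i x < pcoord i b].
Definition cbox a b : set (pt3 R) :=
  [set x | forall i, pcoord i a <= pcoord i x <= pcoord i b].

Lemma cboxE a b : cbox a b =
  (`[a.1.1, b.1.1]%classic `*` `[a.1.2, b.1.2]%classic) `*` `[a.2, b.2]%classic.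
Proof.
apply/seteqP; split=> [[[x y] z] h|[[x y] z] [[/= h1 h2] h3]].
  have := (h 0, h 1, h 2); rewrite !pcoordE => -[[h1 h2] h3].
  by do 2?split; rewrite /= in_itv.
by elim/ord3_ind; rewrite !pcoordE //=; move: h1 h2 h3; rewrite !in_itv.
Qed.

Lemma box_cbox a b : box a b `<=` cbox a b.
Proof. by move=> x h i; have /andP[/ltW -> /ltW ->] := h i. Qed.

Lemma measurable_cap3 (A : 'I_3 -> set (mpt3 R)) :
  (forall i, measurable (A i)) -> measurable [set x | forall i, A i x].
Proof.
move=> mA; rewrite (_ : [set x | _] = A 0 `&` A 1 `&` A 2).
  by apply: measurableI => //; apply: measurableI.
apply/seteqP; split=> x /=; first by [].
by move=> [[h0 h1] h2]; elim/ord3_ind.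
Qed.

Lemma measurable_pcoord_itv i (I : interval R) :
  measurable ([set x | pcoord i x \in I] : set (mpt3 R)).
Proof.
rewrite -[X in measurable X]setTI.
by apply: (measurable_pcoord i measurableT (Y := [set` I])); exact: measurable_itv.
Qed.

Lemma measurable_box a b : measurable (box a b : set (mpt3 R)).
Proof.
apply: (@measurable_cap3 (fun i => [set x | pcoord i x \in `]pcoord i a, pcoord i b[])) => i.
exact: measurable_pcoord_itv.
Qed.

Lemma measurable_cbox a b : measurable (cbox a b : set (mpt3 R)).
Proof.
apply: (@measurable_cap3 (fun i => [set x | pcoord i x \in `[pcoord i a, pcoord i b]])) => i.
exact: measurable_pcoord_itv.
Qed.

Definition rpt (q : rat * rat * rat) : pt3 R := (ratr q.1.1, ratr q.1.2, ratr q.2).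

Lemma ball3P x y e : ball x e y <-> forall i, `|pcoord i x - pcoord i y| < e.
Proof.
split.
  by move=> [[h1 h2] h3]; elim/ord3_ind; rewrite !pcoordE.
by move=> h; have := (h 0, h 1, h 2); rewrite !pcoordE => -[[h0 h1] h2].
Qed.

(** Rational corners make the family of boxes countable; the closed box inside [U] later serves as
    the compact support of a bump. *)
Lemma open_rbox U x : open U -> U x ->
  exists p q, box (rpt p) (rpt q) x /\ cbox (rpt p) (rpt q) `<=` U.
Proof.
move=> oU Ux; have /nbhs_ballP[e /= e0 xeU] := open_nbhs_nbhs (conj oU Ux).
have rI (s t : R) : s < t -> {q : rat | s < ratr q < t}.
  move=> st; apply: cid; have [q] := rat_in_itvoo st.
  by rewrite in_itv /=; exists q.
have Hl i : pcoord i x - e < pcoord i x by rewrite ltrBlDr ltrDl.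
have Hr i : pcoord i x < pcoord i x + e by rewrite ltrDl.
pose l i := sval (rI _ _ (Hl i)); pose r i := sval (rI _ _ (Hr i)).
exists (l 0, l 1, l 2), (r 0, r 1, r 2).
have cl i : pcoord i (rpt (l 0, l 1, l 2)) = ratr (l i).
  by elim/ord3_ind: i; rewrite pcoordE.
have cr i : pcoord i (rpt (r 0, r 1, r 2)) = ratr (r i).
  by elim/ord3_ind: i; rewrite pcoordE.
split=> [i|y yb].
  rewrite cl cr.
  have := svalP (rI _ _ (Hl i)); have := svalP (rI _ _ (Hr i)); rewrite -/(l i) -/(r i).
  by move=> /andP[-> _] /andP[_ ->].
apply: xeU; apply/ball3P => i; have := yb i; rewrite cl cr => /andP[h1 h2].
have := svalP (rI _ _ (Hl i)); have := svalP (rI _ _ (Hr i)); rewrite -/(l i) -/(r i).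
move=> /andP[_ h3] /andP[h4 _].
by rewrite distrC ltr_distl (lt_le_trans h4 h1) (le_lt_trans h2 h3).
Qed.

Lemma open_bigcup_rbox U : open U ->
  U = \bigcup_(pq in [set pq | cbox (rpt pq.1) (rpt pq.2) `<=` U])
        box (rpt pq.1) (rpt pq.2).
Proof.
move=> oU; apply/seteqP; split=> [x Ux|x [[p q] /= sU] bx].
  by have [p [q [h1 h2]]] := open_rbox oU Ux; exists (p, q).
by apply: sU; exact: box_cbox.
Qed.

(** The sigma-algebra on [mpt3 R] is the product one, not the one generated by the topology; the
    countable cover by rational boxes links the two. *)
Lemma open_measurable3 U : open U -> measurable (U : set (mpt3 R)).
Proof.
move=> /open_bigcup_rbox ->; rewrite bigcup_mkcond.
apply: (countable_bigcupT_measurable (U := ((rat * rat * rat) * (rat * rat * rat))%type)).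
  exact: countableP.
by move=> pq; case: ifPn => // _; exact: measurable_box.
Qed.

Lemma continuous_measurable3 (f : pt3 R -> R) : continuous f ->
  measurable_fun [set: mpt3 R] (f : mpt3 R -> measurableTypeR R).
Proof.
move=> /continuousP cf; apply: (measurability _ (RGenOInfty.measurableE R)).
move=> _ [_ [a ->] <-]; rewrite setTI; apply: open_measurable3.
exact/cf/interval_open.
Qed.

Local Notation leb := (@lebesgue_measure R).

Lemma leb3_cbox_lty a b : (@leb3 R (cbox a b) < +oo)%E.
Proof.
rewrite cboxE.
have fin (s t : R) : leb `[s, t]%classic \is a fin_num.
  by rewrite /= lebesgue_measure_itv /=; case: ifP.
rewrite -[leb3 _]/(((leb \x leb) \x leb)%E _) product_measure1E //; last exact: measurableX.
rewrite -[X in (X * _)%E]/((leb \x leb)%E _) product_measure1E //.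
by rewrite ltey_eq !fin_numM ?orbT // fin.
Qed.

Lemma bounded_cbox U : bounded_set U -> exists a b, U `<=` cbox a b.
Proof.
move=> [M [Mr HM]].
exists (- (M + 1), - (M + 1), - (M + 1)), (M + 1, M + 1, M + 1) => x Ux.
have /(_ x Ux) := HM (M + 1) (ltr_pwDr ltr01 (lexx M)).
rewrite /= !prod_normE !ge_max => /andP[/andP[h0 h1] h2].
by elim/ord3_ind; rewrite !pcoordE /= -ler_norml.
Qed.

Local Notation mu := (@leb3 R).

Lemma bounded_lty (U : set (mpt3 R)) : measurable U -> bounded_set (U : set (pt3 R)) ->
  (mu U < +oo)%E.
Proof.
move=> mU /bounded_cbox[a [b Uab]]; apply: le_lt_trans (leb3_cbox_lty a b).
by apply: le_measure => //; rewrite inE //; exact: measurable_cbox.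
Qed.

(* The filter instance of {ae leb3, _} is not found by unification; these two
   lemmas supply it. *)
Lemma leb3_aeS (P Q : pt3 R -> Prop) : (forall x, P x -> Q x) ->
  {ae mu, forall x, P x} -> {ae mu, forall x, Q x}.
Proof. exact: (@filterS _ _ (ae_filter_ringOfSetsType mu)). Qed.

Lemma leb3_aeI (P Q : pt3 R -> Prop) :
  {ae mu, forall x, P x} -> {ae mu, forall x, Q x} ->
  {ae mu, forall x, P x /\ Q x}.
Proof. exact: (@filterI _ _ (ae_filter_ringOfSetsType mu)). Qed.

(** * Square-integrable functions on a measurable set *)

Section L2.
Variable Omega : set (mpt3 R).
Hypothesis mO : measurable Omega.

Lemma L2_add u v : L2 Omega u -> L2 Omega v -> L2 Omega (fun x => u x + v x).
Proof.
move=> hu hv; rewrite /L2 (_ : _ \_ _ = (u \_ Omega) + (v \_ Omega)).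
  by apply: (Lfun_addr_closed _ _).2 => //; rewrite lee1n.
by apply/funext => x; rewrite !fctE !patchE; case: ifP; rewrite ?addr0.
Qed.

Lemma L2_scale c u : L2 Omega u -> L2 Omega (fun x => c * u x).
Proof.
move=> hu; rewrite /L2 (_ : _ \_ _ = c \o* (u \_ Omega)).
  by apply: Lfun_scale => //; rewrite ler1n.
by apply/funext => x; rewrite /= !patchE; case: ifP; rewrite ?mul0r // mulrC.
Qed.

Lemma L2_opp u : L2 Omega u -> L2 Omega (fun x => - u x).
Proof.
by move=> /(L2_scale (-1)); under eq_fun do rewrite mulN1r.
Qed.

Lemma L2_sub u v : L2 Omega u -> L2 Omega v -> L2 Omega (fun x => u x - v x).
Proof. by move=> hu hv; apply: L2_add => //; exact: L2_opp. Qed.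

Lemma L2_measurable u : L2 Omega u -> measurable_fun Omega (u : mpt3 R -> measurableTypeR R).
Proof.
rewrite /L2 inE => /andP[+ _]; rewrite inE /= => h.
by apply/(measurable_restrictT _ mO).
Qed.

Lemma L2_mul_integrable u v : L2 Omega u -> L2 Omega v ->
  mu.-integrable Omega (fun x => (u x * v x)%:E).
Proof.
move=> hu hv; have := Lfun2_mul_Lfun1 hu hv.
move=> /Lfun1_integrable; set f := EFin \o _ => intf.
apply/integrable_mkcond => //; apply: eq_integrable intf => // x _.
by rewrite /f /= !patchE; case: ifP; rewrite ?mul0r.
Qed.

(** For exponent 2 the norm is a power of the integral of [u x * u x], so it is finite as soon as
    that integral is. *)
Lemma L2_integrable_sqr u :
  measurable_fun Omega (u : mpt3 R -> measurableTypeR R) ->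
  mu.-integrable Omega (fun x => (u x * u x)%:E) -> L2 Omega u.
Proof.
move=> mf /(integrable_mkcond _ mO) /integrable_lty iu.
rewrite /L2 inE; apply/andP; split; rewrite inE /=.
  exact/(measurable_restrictT _ mO).
rewrite /finite_norm unlock /Lnorm; apply: poweR_lty.
apply: le_lt_trans (iu measurableT); rewrite le_eqVlt; apply/orP; left; apply/eqP.
apply: eq_integral => x _; rewrite poweR_EFin powR_mulrn // real_normK ?num_real // expr2.
by rewrite !patchE; case: ifP; rewrite ?mul0r.
Qed.

Lemma L2_bounded u M : (mu Omega < +oo)%E ->
  measurable_fun Omega (u : mpt3 R -> measurableTypeR R) ->
  (forall x, Omega x -> `|u x| <= M) -> L2 Omega u.
Proof.
move=> finO mf hM; apply: L2_integrable_sqr => //.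
pose f : mpt3 R -> R := fun x => u x * u x.
apply: (@measurable_bounded_integrable _ _ _ _ f _ mO) => //.
  exact: measurable_funM.
exists (M * M); split; first exact: num_real.
move=> M' MM' x Ox; rewrite /= /f normrM (le_trans _ (ltW MM')) //.
by apply: ler_pM => //; exact: hM.
Qed.

End L2.

Lemma L2_subset (A B : set (mpt3 R)) u : measurable A -> measurable B -> A `<=` B ->
  L2 B u -> L2 A u.
Proof.
move=> mA mB AB hu; apply: L2_integrable_sqr => //.
  exact: (measurable_funS mB AB (L2_measurable mB hu)).
exact: (integrableS mB mA AB (L2_mul_integrable mB hu hu)).
Qed.

Lemma compact_bound (g : pt3 R -> R) (C : set (pt3 R)) : compact C ->
  continuous g -> exists M, forall x, C x -> `|g x| <= M.
Proof.
move=> cC cg; have : compact (g @` C).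
  by apply: continuous_compact => //; exact: continuous_subspaceT.
move=> /compact_bounded [M [_ HM]]; exists (`|M| + 1) => x Cx.
by apply: (HM (`|M| + 1)); [rewrite (le_lt_trans (ler_norm M)) // ltrDl|exists x].
Qed.

End R3.

(** * Directional derivatives and smooth bump functions *)

Section slice.
Context {R : realType}.

Lemma is_derive_ext {V : normedModType R} (f g : V -> R) (x v : V) d d' :
  f =1 g -> d = d' -> is_derive x v f d -> is_derive x v g d'.
Proof. by move=> /funext -> ->. Qed.

Lemma is_deriveP {V : normedModType R} (f : V -> R) (x v : V) (d : R) :
  is_derive x v f d <->
  (fun h : R => h^-1 *: (f (h *: v + x) - f x)) @ 0^' --> d.
Proof.
split=> [[h1 <-]|h]; first exact: h1.
by split; [apply/cvg_ex; exists d|exact: cvg_lim h].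
Qed.

(** Both sides have the same difference quotient. This is how the one-variable mean value theorem
    and fundamental theorem of calculus are brought to R^3. *)
Lemma is_derive_slice {V : normedModType R} (f : V -> R) (x v : V) (t d : R) :
  is_derive (x + t *: v) v f d <->
  is_derive t (1 : R) (fun s : R => f (x + s *: v)) d.
Proof.
rewrite !is_deriveP; set F := (X in X @ _ --> _); set G := (X in _ <-> X @ _ --> _).
rewrite (_ : F = G) //; apply/funext => h; rewrite /F /G.
by rewrite scalerDl scaler1 addrCA.
Qed.

Lemma pcoord_basis (i j : 'I_3) : pcoord i (@Defs.basis R j) = (i == j)%:R.
Proof.
by elim/ord3_ind: i; rewrite pcoordE /Defs.basis /pt /= mxE; elim/ord3_ind: j.
Qed.

Lemma pcoordD i (x y : pt3 R) : pcoord i (x + y) = pcoord i x + pcoord i y.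
Proof. by elim/ord3_ind: i; rewrite !pcoordE. Qed.

Lemma pcoordZ i (a : R) (x : pt3 R) : pcoord i (a *: x) = a * pcoord i x.
Proof. by elim/ord3_ind: i; rewrite !pcoordE. Qed.

(** In direction [j], coordinate [i] moves at unit speed if [i] is [j] and stays fixed otherwise. *)
Lemma is_derive_coord (g : R -> R) (x : pt3 R) (i j : 'I_3) d :
  is_derive (pcoord i x) (1 : R) g d ->
  is_derive x (Defs.basis j) (fun y => g (pcoord i y)) ((i == j)%:R * d).
Proof.
rewrite !is_deriveP => h.
have E h' : pcoord i (h' *: Defs.basis j + x) = h' *: ((i == j)%:R : R) + pcoord i x.
  by rewrite pcoordD pcoordZ pcoord_basis.
under eq_fun do rewrite E.
have [ij|ij] := eqVneq i j; first by rewrite mul1r; exact: h.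
under eq_fun do rewrite scaler0 add0r subrr scaler0.
by rewrite mul0r; exact: cvg_cst.
Qed.

End slice.

Section bump.
Context {R : realType}.

(** The classical function exp(-1/t), flat at 0, times t^(-k): with these powers the family is
    closed under differentiation up to linear combinations. *)
Definition flat_exp (k : nat) (t : R) : R :=
  if 0 < t then t^-1 ^+ k * expR (- t^-1) else 0.

Lemma flat_exp_ge0 k t : 0 <= flat_exp k t.
Proof.
rewrite /flat_exp; case: ifP => // t0.
by rewrite mulr_ge0 ?expR_ge0 // exprn_ge0 // invr_ge0 ltW.
Qed.

(** With s = 1/t, the bound exp s >= s^(k+1) / (k+1)! gives s^k exp(-s) <= (k+1)! t. *)
Lemma flat_exp_bound k t : `|flat_exp k t| <= (k.+1)`!%:R * `|t|.
Proof.
rewrite /flat_exp; case: ifPn => t0; last by rewrite normr0 mulr_ge0.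
have s0 : 0 < t^-1 by rewrite invr_gt0.
rewrite ger0_norm; last by rewrite mulr_ge0 ?expR_ge0 // exprn_ge0 // ltW.
rewrite (gtr0_norm t0) expRN ler_pdivrMr ?expR_gt0 //.
have := expR_ge1Dxn k (ltW s0); set f := (_`!)%:R => h.
have f0 : 0 < f by rewrite /f ltr0n fact_gt0.
have : t^-1 ^+ k.+1 / f <= expR t^-1 by apply: le_trans h; rewrite lerDr.
rewrite ler_pdivrMr // => h'.
rewrite exprS in h'.
have := ler_wpM2l (ltW t0) h'; rewrite mulrA divff ?gt_eqF // mul1r.
by rewrite (_ : f * t * _ = t * (expR t^-1 * f)) //; ring.
Qed.

Lemma flat_exp_cvg0 k : flat_exp k t @[t --> 0] --> 0.
Proof.
apply/norm_cvg0P.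
apply: (@squeeze_cvgr _ _ _ _ (cst 0) (fun t => (k.+1)`!%:R * `|t|)).
- by apply: nearW => t; rewrite normr_ge0 flat_exp_bound.
- exact: cvg_cst.
- rewrite -[X in _ --> X](mulr0 (k.+1)`!%:R); apply: cvgMr.
  by rewrite -[X in _ --> X](normr0 R); apply: cvg_norm; exact: cvg_id.
Qed.

(* At 0 the difference quotient of flat_exp k is flat_exp k.+1. *)
Lemma is_derive_flat_exp k t :
  is_derive t (1 : R) (flat_exp k) (flat_exp k.+2 t - k%:R * flat_exp k.+1 t).
Proof.
case: (ltgtP t 0) => [t0|t0|->].
- apply: (@near_eq_is_derive _ _ _ (cst 0)).
    near=> s; rewrite /flat_exp ifF // ltNge; apply/negbF/ltW.
    by near: s; exact: lt_nbhsl.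
  apply: (is_derive_ext (f := cst 0) (d := 0)) => //.
  by rewrite /flat_exp ltNge (ltW t0) /= mulr0 subr0.
- apply: (@near_eq_is_derive R R R (fun t : R => t^-1 ^+ k * expR (- t^-1))).

    near=> s; rewrite /flat_exp ifT //.
    by near: s; exact: lt_nbhsr.
  have tn0 : t != 0 by rewrite gt_eqF.
  have d1 : is_derive t (1 : R) (fun s => s^-1) (- t ^- 2 *: 1).
    exact: (is_deriveV (f := id)).
  have d2 := is_deriveX k d1.
  have d3 : is_derive t (1:R) (fun s => expR (- s^-1)) (expR (- t^-1) * (t ^- 2)).
    have := @is_derive1_comp R expR (fun s => - s^-1) t _ _ (is_derive_expR _) (is_deriveN d1).
    by apply: is_derive_ext => //; rewrite /= scaler1 opprK.
  have := is_deriveM d2 d3; apply: is_derive_ext; first by move=> s; rewrite !fctE.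
  rewrite exprfctE /flat_exp t0 /= /GRing.scale /= -!exprVn.
  case: k {d2} => [|k] /=; first by rewrite !mul0r mulr0 addr0 subr0 !expr0 mul1r mulrC.
  rewrite !mulr1 !exprS; ring.
- rewrite /flat_exp ltxx mulr0 subr0.
  have E : h^-1 *: (flat_exp k (h *: (1 : R) + 0) - flat_exp k 0) @[h --> 0^'] --> (0 : R).
    have : flat_exp k.+1 h @[h --> 0^'] --> (0 : R).
      by apply: cvg_within_filter; exact: flat_exp_cvg0.
    apply: cvg_trans; apply: near_eq_cvg; near=> h.
    have hn0 : h != 0 by near: h; exact: nbhs_dnbhs_neq.
    rewrite /flat_exp /= ltxx subr0 addr0 [h *: 1]mulr1; case: ifP => _; last by rewrite scaler0.
    by rewrite /GRing.scale /= mulrA -exprS.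
  exact/is_deriveP.
Unshelve. all: by end_near. Qed.

(** A syntactic class stable under differentiation, so that all derivatives exist at once by
    induction, without a separate notion of one-variable smoothness. *)
Inductive bumpfun : (R -> R) -> Prop :=
| bumpfun_flat_exp k m c : bumpfun (fun t => flat_exp k (m * t + c))
| bumpfunZ a f : bumpfun f -> bumpfun (fun t => a * f t)
| bumpfunD f g : bumpfun f -> bumpfun g -> bumpfun (fun t => f t + g t)
| bumpfunM f g : bumpfun f -> bumpfun g -> bumpfun (fun t => f t * g t).

Lemma bumpfun_derive f : bumpfun f ->
  exists2 f', bumpfun f' & forall t : R, is_derive t (1 : R) f (f' t).
Proof.
elim=> {f} [k m c|a f _ [f' hf df]|f g hf [f' hf' df] hg [g' hg' dg]
  |f g hf [f' hf' df] hg [g' hg' dg]].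
- exists (fun t => m * (flat_exp k.+2 (m * t + c) + (- k%:R) * flat_exp k.+1 (m * t + c))).
    apply: bumpfunZ; apply: bumpfunD; first exact: bumpfun_flat_exp.
    by apply: bumpfunZ; exact: bumpfun_flat_exp.
  move=> t.
  have d : is_derive t (1 : R) (fun t => m * t + c) m.
    apply: (is_derive_ext (f := m \*: id + cst c) (d := m *: 1 + 0)) => //.
    by rewrite addr0 scaler1.
  have := @is_derive1_comp R (flat_exp k) (fun t => m * t + c) t _ _ (is_derive_flat_exp _ _) d.
  by apply: is_derive_ext => //; ring.
- exists (fun t => a * f' t); first exact: bumpfunZ.
  move=> t; have := df t => dft.
  exact: (is_derive_ext (f := a \*: f) (d := a *: f' t)).
- exists (fun t => f' t + g' t); first exact: bumpfunD.
  move=> t; have := df t => dft; have := dg t => dgt.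
  exact: (is_derive_ext (f := f + g) (d := f' t + g' t)).
- exists (fun t => f t * g' t + g t * f' t).
    by apply: bumpfunD; apply: bumpfunM.
  move=> t; have := df t => dft; have := dg t => dgt.
  exact: (is_derive_ext (f := f * g) (d := f t *: g' t + g t *: f' t)).
Qed.

Lemma is_derive_continuous (f : R -> R) (t d : R) :
  is_derive t (1 : R) f d -> {for t, continuous f}.
Proof. by move=> [/derivable1_diffP/differentiable_continuous]. Qed.

Definition prod3 (u : 'I_3 -> R -> R) (x : pt3 R) : R :=
  u 0 (pcoord 0 x) * u 1 (pcoord 1 x) * u 2 (pcoord 2 x).

(** A partial derivative hits a single factor, so the result is again a product of functions of one
    coordinate each. *)
Lemma partial_prod3 (u u' : 'I_3 -> R -> R) (x : pt3 R) (j : 'I_3) :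
  (forall i t, is_derive t (1 : R) (u i) (u' i t)) ->
  is_derive x (Defs.basis j) (prod3 u)
    (prod3 (fun i => if i == j then u' i else u i) x).
Proof.
move=> du.
have d i := is_derive_coord j (du i (pcoord i x)).
have := is_deriveM (is_deriveM (d 0) (d 1)) (d 2).
apply: is_derive_ext => //.
rewrite /prod3 !fctE /GRing.scale /=.
elim/ord3_ind: j {d}; rewrite ?ord3_neq ?eqxx ?mulr0n ?mulr1n; ring.
Qed.

Lemma prod3_smooth (u : 'I_3 -> R -> R) : (forall i, bumpfun (u i)) ->
  smooth (prod3 u).
Proof.
move=> hu s.
(* Every iterated partial derivative is again a product of [bumpfun]s, so continuity and
   derivability only have to be checked for such a product. *)
have {u hu} [u hu ->] : exists2 v, (forall i, bumpfun (v i)) &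
    foldr partial (prod3 u) s = prod3 v.
  elim: s => [|j s [v hv IH]] /=; first by exists u.
  have /choice[v' hv'] : forall i, exists v', bumpfun v' /\
      forall t : R, is_derive t (1 : R) (v i) (v' t).
    by move=> i; have [v' h1 h2] := bumpfun_derive (hv i); exists v'.
  exists (fun i => if i == j then v' i else v i).
    by move=> i; case: eqP => // _; exact: (hv' i).1.
  apply/funext => x; rewrite IH /partial.
  by have [] := partial_prod3 x j (fun i => (hv' i).2).
have /choice[u' hu'] : forall i, exists v', bumpfun v' /\
    forall t : R, is_derive t (1 : R) (u i) (v' t).
  by move=> i; have [v' h1 h2] := bumpfun_derive (hu i); exists v'.
split; last first.
  by move=> j x; have [] := partial_prod3 x j (fun i => (hu' i).2).
have c i : continuous (fun x => u i (pcoord i x)).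
  move=> x; apply: continuous_comp; first exact: pcoord_continuous.
  exact: is_derive_continuous ((hu' i).2 _).
by move=> x; apply: cvgM; [apply: cvgM|]; exact: c.
Qed.

End bump.

(** * Functions with vanishing integrals over a pi-system *)

Section nng_induced.
Context d (T : measurableType d) (R : realType) (mu : {measure set T -> \bar R}).
Variable f : T -> \bar R.
Hypotheses (mf : measurable_fun [set: T] f) (f0 : forall x, (0 <= f x)%E).

(** The measure with density [f]. Turning the positive and negative parts of a density into measures
    makes the uniqueness theorem for measures on a pi-system applicable. *)
Definition nng_induced (A : set T) : \bar R := (\int[mu]_(x in A) f x)%E.

Let nng0 : nng_induced set0 = 0%E. Proof. exact: integral_set0. Qed.
Let nng_ge0 A : (0 <= nng_induced A)%E. Proof. exact: integral_ge0. Qed.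
Let nng_additive : semi_sigma_additive nng_induced.
Proof. exact: semi_sigma_additive_nng_induced. Qed.

HB.instance Definition _ := isMeasure.Build _ _ _ nng_induced nng0 nng_ge0 nng_additive.

Definition nng_measure : {measure set T -> \bar R} := nng_induced.

End nng_induced.

Section integral_unique.
Context d (T : measurableType d) (R : realType) (mu : {measure set T -> \bar R}).

(** The measures with densities [f^\+] and [f^\-] are finite and agree on the pi-system [G], hence
    on all measurable sets. So [f] has zero integral over every measurable set and vanishes a.e. The
    sequence [g] is the exhaustion that the uniqueness theorem asks for. *)
Lemma integrable_pisystem_eq0 (G : set (set T)) (g : (set T)^nat) (f : T -> \bar R) :
  measurable = <<s G >> -> setI_closed G -> (forall n, G (g n)) ->
  \bigcup_n g n = setT -> mu.-integrable setT f ->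
  (forall A, G A -> (\int[mu]_(x in A) f x = 0)%E) ->
  {ae mu, forall x, f x = 0%E}.
Proof.
move=> GE GI Gg gT intf f0.
have mf := measurable_int mu intf.
have mp := measurable_funepos mf; have mn := measurable_funeneg mf.
have mG A : G A -> measurable A by rewrite GE; exact: sub_sigma_algebra.
pose np := nng_measure mu mp (fun x => funepos_ge0 f x).
pose nn := nng_measure mu mn (fun x => funeneg_ge0 f x).
have finp A : measurable A -> (np A < +oo)%E.
  move=> mA; have h := integrableS measurableT mA (@subsetT _ _) intf.
  exact: (integral_funepos_lt_pinfty mA h).
have finn A : measurable A -> (nn A < +oo)%E.
  move=> mA; have h := integrableS measurableT mA (@subsetT _ _) intf.
  exact: (integral_funeneg_lt_pinfty mA h).
have E A : measurable A -> np A = nn A.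
  apply: (measure_unique G g) => // [B GB|k]; last exact/finp/mG.
  have mB := mG _ GB; have := f0 _ GB.
  rewrite integralE -/(nng_induced mu _ B) -[nng_induced mu f^\+%E B]/(np B).
  rewrite -/(nng_induced mu _ B) -[nng_induced mu f^\-%E B]/(nn B).
  have := finp _ mB; have := finn _ mB.
  have := measure_ge0 np B; have := measure_ge0 nn B.
  move: (np B) (nn B) => [r| |] [s| |] //= _ _ _ _ /eqP.
  by rewrite -EFinB eqe subr_eq0 => /eqP ->.
have := @integral_ae_eq _ _ _ mu setT measurableT (cst 0%E) f intf (@measurable_cst _ _ _ _ _ _).
move=> H; have {}H : ae_eq mu setT f (cst 0%E).
  apply: H => A _ mA; rewrite integralE integral_cst // mul0e.
  rewrite -/(nng_induced mu _ A) -[nng_induced mu f^\+%E A]/(np A).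
  rewrite -/(nng_induced mu _ A) -[nng_induced mu f^\-%E A]/(nn A).
  by rewrite E // subee // ge0_fin_numE ?finn //; exact: measure_ge0.
by apply: filterS H => x; apply.
Qed.

End integral_unique.

Section octant.
Context {R : realType}.

(** These sets are chosen as the pi-system because the intersection of an octant with an open box is
    again such a box, where the integrals are known. *)
Definition octant (a : pt3 R) : set (pt3 R) := [set x | forall i, pcoord i a < pcoord i x].
Definition octants : set (set (pt3 R)) := range octant.

Lemma octants_setI : setI_closed octants.
Proof.
move=> _ _ [a _ <-] [b _ <-]; exists (mkpt (fun i => Num.max (pcoord i a) (pcoord i b))) => //.
apply/seteqP; split=> x.
  by move=> h; split=> i; have := h i; rewrite pcoord_mkpt gt_max => /andP[].
by move=> [h1 h2] i; rewrite pcoord_mkpt gt_max h1 h2.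
Qed.

Lemma bigcup_octant : \bigcup_n octant (mkpt (fun=> - n%:R)) = setT.
Proof.
apply/seteqP; split=> // x _.
pose M := \sum_i `|pcoord i x|.
exists (Num.bound M) => // i; rewrite pcoord_mkpt ltrNl.
apply: (@le_lt_trans _ _ `|pcoord i x|); first by rewrite -normrN ler_norm.
apply: (@le_lt_trans _ _ M); last first.
  by apply: archi_boundP; apply: sumr_ge0.
by rewrite /M (bigD1 i) //= lerDl sumr_ge0.
Qed.

(** For the inclusion of the product sigma-algebra in the generated one, it suffices that each
    coordinate is measurable for the latter, since then so is the identity map. *)
Lemma measurable_octants :
  @measurable _ (mpt3 R) = <<s octants >>.
Proof.
apply/seteqP; split; last first.
  apply: smallest_sub; first exact: sigma_algebra_measurable.
  move=> _ [a _ <-].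
  rewrite (_ : octant a = [set x | forall i, [set x | pcoord i x \in `]pcoord i a, +oo[] x]).
    apply: measurable_cap3 => i.
    exact: measurable_pcoord_itv.
  by apply/seteqP; split=> x h i; have := h i; rewrite /= in_itv /= andbT.
pose T' := g_sigma_algebraType octants.
have mc i : measurable_fun [set: T'] (pcoord i : T' -> measurableTypeR R).
  apply: (measurability _ (RGenOInfty.measurableE R)).
  move=> _ [_ [a ->] <-]; rewrite setTI.
  (* An open half-space is the union of octants with corner [a] in coordinate [i] and [- n] in the
     other two. *)
  rewrite [X in measurable X](_ : _ = \bigcup_n octant
     (mkpt (fun j => if j == i then a else - n%:R))).
    apply: bigcupT_measurable => n; apply: sub_sigma_algebra.
    by exists (mkpt (fun j => if j == i then a else - n%:R)).
  apply/seteqP; split=> x.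
    rewrite /= in_itv /= andbT => ax.
    have [n _ hn] : (\bigcup_n octant (mkpt (fun=> - n%:R))) x by rewrite bigcup_octant.
    exists n => // j; rewrite pcoord_mkpt; case: eqP => [->//|_].
    by have := hn j; rewrite pcoord_mkpt.
  by move=> [n _ /(_ i)]; rewrite pcoord_mkpt eqxx /= in_itv /= andbT.
have mid : measurable_fun [set: T'] (id : T' -> mpt3 R).
  apply/measurable_fun_pairP; split.
    apply/measurable_fun_pairP; split.
      by have := mc 0; rewrite pcoord_funE.
    by have := mc 1; rewrite pcoord_funE.
  by have := mc 2; rewrite pcoord_funE.
by move=> A mA; have := mid measurableT A mA; rewrite setTI.
Qed.

End octant.

(** * The fundamental lemma of the calculus of variations *)

Section boxbump.
Context {R : realType}.
Implicit Types (a b x : pt3 R) (n : nat).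

Lemma flat_exp0_le1 (t : R) : flat_exp 0 t <= 1.
Proof.
rewrite /flat_exp; case: ifP => // t0.
by rewrite expr0 mul1r -[leRHS]expR0 ler_expR oppr_le0 invr_ge0 ltW.
Qed.

(* Tends to the indicator function of the open box as n tends to infinity. *)
Definition boxbump a b n : pt3 R -> R :=
  prod3 (fun i t => flat_exp 0 (n.+1%:R * t + - (n.+1%:R * pcoord i a)) *
                    flat_exp 0 (- n.+1%:R * t + n.+1%:R * pcoord i b)).

Lemma boxbump_smooth a b n : smooth (boxbump a b n).
Proof. by apply: prod3_smooth => i; apply: bumpfunM; exact: bumpfun_flat_exp. Qed.

Lemma boxbump_norm a b n x : `|boxbump a b n x| <= 1.
Proof.
rewrite /boxbump /prod3 !normrM !(ger0_norm (flat_exp_ge0 _ _)).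
by do !apply: mulr_ile1 => //; rewrite ?mulr_ge0 ?flat_exp_ge0 ?flat_exp0_le1.
Qed.

Lemma boxbump_out a b n x : ~ box a b x -> boxbump a b n x = 0.
Proof.
move=> nb; have [i hi] : exists i, ~ (pcoord i a < pcoord i x < pcoord i b).
  exact/existsNP.
have : flat_exp 0 (n.+1%:R * pcoord i x + - (n.+1%:R * pcoord i a)) *
       flat_exp 0 (- n.+1%:R * pcoord i x + n.+1%:R * pcoord i b) = 0.
  apply/eqP; rewrite mulf_eq0 /flat_exp.
  have [ax|ax] := ltP (pcoord i a) (pcoord i x).
    have xb : pcoord i b <= pcoord i x.
      by rewrite leNgt; apply/negP => xb; apply: hi; rewrite ax xb.
    rewrite (ifF _ _ (_ : (0 < - n.+1%:R * _ + _) = false)) ?eqxx ?orbT //.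
    by apply/negbTE; rewrite -leNgt mulNr addrC subr_le0 ler_wpM2l.
  rewrite ifF ?eqxx //.
  by apply/negbTE; rewrite -leNgt subr_le0 ler_wpM2l.
rewrite /boxbump /prod3; elim/ord3_ind: i {hi nb} => ->; ring.
Qed.

Lemma flat_exp0_cvg1 (c : R) : 0 < c -> flat_exp 0 (n.+1%:R * c) @[n --> \oo] --> (1 : R).
Proof.
move=> c0.
rewrite (_ : (fun n => _) = (fun n => expR (- (c^-1 * n.+1%:R^-1)))); last first.
  by apply/funext => n; rewrite /flat_exp mulr_gt0 // expr0 mul1r invfM mulrC.
rewrite -[X in _ --> X]expR0 -[X in _ --> expR X]oppr0 -[X in _ --> expR (- X)](mulr0 c^-1).
apply: (@continuous_cvg _ _ _ _ _ _ expR); first exact: continuous_expR.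
by apply: cvgN; apply: cvgM; [exact: cvg_cst|exact: cvg_harmonic].
Qed.

Lemma boxbump_in a b x : box a b x -> boxbump a b n x @[n --> \oo] --> (1 : R).
Proof.
move=> bx; rewrite -[X in _ --> X]mulr1 -[X in _ --> (X * _ : R)]mulr1.
have c i : flat_exp 0 (n.+1%:R * pcoord i x + - (n.+1%:R * pcoord i a)) *
       flat_exp 0 (- n.+1%:R * pcoord i x + n.+1%:R * pcoord i b) @[n --> \oo] --> (1 : R).
  have /andP[h1 h2] := bx i; rewrite -[X in _ --> X]mulr1; apply: cvgM.
    by under eq_fun do rewrite -mulrBr; apply: flat_exp0_cvg1; rewrite subr_gt0.
  under eq_fun do rewrite mulNr addrC -mulrBr.
  by apply: flat_exp0_cvg1; rewrite subr_gt0.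
by apply: cvgM; [apply: cvgM|]; exact: c.
Qed.

Lemma compact_cbox a b : compact (cbox a b).
Proof.
rewrite cboxE; apply: compact_setX; last exact: segment_compact.
by apply: compact_setX; exact: segment_compact.
Qed.

Lemma test_boxbump U a b n : cbox a b `<=` U -> test_fun U (boxbump a b n).
Proof.
move=> bU; split; first exact: boxbump_smooth.
exists (cbox a b); split=> //; first exact: compact_cbox.
by move=> x nx; apply: boxbump_out => /box_cbox.
Qed.

Lemma test_fun_continuous U (u : pt3 R -> R) : test_fun U u -> continuous u.
Proof. by move=> [/(_ [::])[]]. Qed.

End boxbump.

Section fundamental_lemma.
Context {R : realType}.
Local Notation mu := (@leb3 R).
Variables (U : set (pt3 R)) (d : pt3 R -> R).
Hypotheses (oU : open U) (finU : (mu U < +oo)%E) (dL2 : L2 U d).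
Hypothesis d0 : forall phi, test_fun U phi -> \int[mu]_(x in U) (d x * phi x) = 0.

Let mU : measurable (U : set (mpt3 R)). Proof. exact: open_measurable3. Qed.

Let intd : mu.-integrable U (EFin \o d).
Proof.
have c1 : L2 U (cst (1 : R)).
  apply: (@L2_bounded _ _ mU _ 1) => //.
  by move=> x _; rewrite normr1.
have := L2_mul_integrable mU dL2 c1.
by apply: eq_integrable => // x _ /=; rewrite mulr1.
Qed.

(** Dominated convergence: the bumps are bounded by 1 and tend to the indicator of the box, so [d]
    times the bump is dominated by the norm of [d], and every term of the sequence of integrals is 0
    by [d0]. *)
Let boxint a b : cbox a b `<=` U -> (\int[mu]_(x in box a b) (d x)%:E = 0)%E.
Proof.
move=> abU.
have bU : box a b `<=` U by move=> x /box_cbox /abU.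
have mb n : measurable_fun (U : set (mpt3 R)) (boxbump a b n : mpt3 R -> measurableTypeR R).
  apply: (measurable_funS measurableT) => //.
  by apply: continuous_measurable3; exact: test_fun_continuous (test_boxbump n abU).
have md : measurable_fun (U : set (mpt3 R)) (d : mpt3 R -> measurableTypeR R).
  exact: L2_measurable dL2.
have [] := @dominated_convergence _ _ _ mu U mU
  (fun n x => (d x * boxbump a b n x)%:E) (fun x => ((EFin \o d) \_ (box a b)) x)
  (fun x => `|d x|%:E).
- by move=> n; apply/measurable_EFinP; exact: (measurable_funM md (mb n)).
- apply/(measurable_restrict _ (measurable_box a b) mU).
  apply: (measurable_funS mU); first exact: subIsetl.
  exact/measurable_EFinP.
- apply: aeW => x Ux; rewrite patchE; case: ifPn => [/set_mem bx|bx].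
    apply: (@cvg_EFin _ _ _ _ _ (d x)); first by apply: nearW.
    rewrite /= -[X in _ --> X]mulr1; apply: cvgM; first exact: cvg_cst.
    exact: boxbump_in.
  rewrite (_ : (fun n => _) = cst 0%E); first exact: cvg_cst.
  by apply/funext => n; rewrite boxbump_out ?mulr0 // => /mem_set; apply/negP.
- exact: integrable_norm.
- apply: aeW => x n Ux; rewrite lee_fin normrM.
  by rewrite -[leRHS]mulr1 ler_wpM2l // boxbump_norm.
move=> _ _ C; have : (fun n : nat => 0 : \bar R)%E @ \oo --> (\int[mu]_(x in U) ((EFin \o d) \_ (box a b)) x)%E.
  apply: cvg_trans C; apply: near_eq_cvg; near=> n => /=.
  have := d0 (test_boxbump n abU); rewrite /Rintegral => h.
  rewrite -[LHS]fineK ?h //.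
  apply: integrable_fin_num => //; apply: L2_mul_integrable => //.
  apply: (@L2_bounded _ _ mU _ 1) => // x _; exact: boxbump_norm.
move=> /(cvg_lim (@ereal_hausdorff R)); rewrite lim_cst //.
by rewrite -integral_mkcondr setIidr.
Unshelve. all: by end_near. Qed.

(** The pi-system criterion is applied to [d] cut off outside the box: over an octant its integral
    is one over a smaller box, whose closed version still lies in [U]. *)
Let rboxint p q : cbox p q `<=` U -> {ae mu, forall x, box p q x -> d x = 0}.
Proof.
move=> pqU.
have bU : box p q `<=` U by move=> x /box_cbox /pqU.
have mb : measurable (box p q : set (mpt3 R)) by exact: measurable_box.
have intb : mu.-integrable (box p q) (EFin \o d) by exact: (integrableS mU mb bU intd).
have := @integrable_pisystem_eq0 _ _ _ mu octants (fun n => octant (mkpt (fun=> - n%:R)))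
  ((EFin \o d) \_ (box p q)).
move=> H; have {}H : {ae mu, forall x, ((EFin \o d) \_ (box p q)) x = 0%E}.
  apply: H.
  - exact: measurable_octants.
  - exact: octants_setI.
  - by move=> n; exists (mkpt (fun=> - n%:R)).
  - exact: bigcup_octant.
  - exact/(integrable_mkcond _ mb).
  move=> _ [a _ <-]; rewrite -integral_mkcondr.
  rewrite (_ : _ `&` _ = box (mkpt (fun i => Num.max (pcoord i p) (pcoord i a))) q).
    apply: boxint => x h; apply: pqU => i; have := h i.
    by rewrite pcoord_mkpt ge_max => /andP[/andP[-> _] ->].
  apply/seteqP; split=> x.
    by move=> [h1 h2] i; rewrite pcoord_mkpt gt_max h1 andbT; exact: h2.
  move=> h; split=> i; have := h i; rewrite pcoord_mkpt gt_max -andbA => /and3P[] //.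
  by move=> -> _ ->.
have := H; apply: leb3_aeS => x; rewrite patchE => + bx; rewrite mem_set //= => h.
exact: EFin_inj h.
Qed.

Lemma test_fun_ae_eq0 : {ae mu, forall x, U x -> d x = 0}.
Proof.
pose I := ((rat * rat * rat) * (rat * rat * rat))%type.
(* Pairs of rational corners are coded by natural numbers, so that the null sets of all boxes can be
   united by [ae_foralln]; codes of no pair or of boxes leaving [U] give a vacuous statement. *)
have H (n : nat) : {ae mu, forall x, forall pq : I, unpickle n = Some pq ->
    cbox (rpt pq.1) (rpt pq.2) `<=` U -> box (rpt pq.1) (rpt pq.2) x -> d x = 0}.
  case En : (unpickle n : option I) => [pq|]; last by apply: aeW.
  have [sU|nsU] := pselect (cbox (@rpt R pq.1) (rpt pq.2) `<=` U); last first.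
    by apply: aeW => x _ [<-].
  by move: (rboxint sU); apply: leb3_aeS => x h _ [<-] _.
have := ae_foralln H.
apply: leb3_aeS => x h Ux.
have [p [q [b1 b2]]] := open_rbox oU Ux.
exact: (h (pickle ((p, q) : I)) (p, q) (pickleK _)).
Qed.

End fundamental_lemma.

(** * Symmetry of second derivatives *)

Section schwarz.
Context {R : realType}.
Local Notation e_ i := (@Defs.basis R i).
Implicit Types (f u : pt3 R -> R) (x y : pt3 R) (i j : 'I_3).

Lemma line_MVT f x (v : pt3 R) (h : R) : 0 < h -> (forall y, derivable f y v) ->
  exists2 c, 0 <= c <= h & f (x + h *: v) - f x = h * 'D_v f (x + c *: v).
Proof.
move=> h0 df.
have dg (t : R) : is_derive t (1 : R) (fun s : R => f (x + s *: v)) ('D_v f (x + t *: v)).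
  exact: (is_derive_slice f x v t _).1 (derivableP (df _)).
have [|c] := @MVT R (fun s : R => f (x + s *: v)) (fun t => 'D_v f (x + t *: v)) 0 h h0 (fun t _ => dg t).
  by apply: continuous_subspaceT => t; exact: is_derive_continuous (dg t).
rewrite in_itv /= => /andP[/ltW c0 /ltW ch] E; exists c; first by rewrite c0 ch.
by move: E; rewrite scale0r addr0 subr0 mulrC.
Qed.

Lemma is_derive_translate f (x v w : pt3 R) (d : R) :
  is_derive (x + w) v f d -> is_derive x v (fun y => f (y + w)) d.
Proof. by rewrite !is_deriveP; under [in X in _ -> X]eq_fun do rewrite -addrA. Qed.

(** The second difference is a first difference, in direction [i], of
    [F y = f (y + h *: e_ j) - f y]. One mean value theorem for [F], then one in direction [j] for
    the partial derivative it produces, give the two factors [h]. *)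
Lemma mixed_difference f x i j (h : R) : 0 < h ->
  (forall y, derivable f y (e_ i)) ->
  (forall y, derivable (partial i f) y (e_ j)) ->
  exists a b, [/\ 0 <= a <= h, 0 <= b <= h &
    f (x + h *: e_ i + h *: e_ j) - f (x + h *: e_ i) - (f (x + h *: e_ j) - f x)
    = h * (h * partial j (partial i f) (x + a *: e_ i + b *: e_ j))].
Proof.
move=> h0 di dj.
pose F y := f (y + h *: e_ j) - f y.
have dF y : is_derive y (e_ i) F (partial i f (y + h *: e_ j) - partial i f y).
  have d1 := is_derive_translate (derivableP (di (y + h *: e_ j))).
  have d2 := derivableP (di y).
  exact: is_derive_ext (is_deriveB d1 d2).
have dF' y : derivable F y (e_ i) by have [] := dF y.
have [a ah E] := line_MVT x h0 dF'.
have [b bh E'] := line_MVT (x + a *: e_ i) h0 dj.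
exists a, b; split => //.
rewrite -/(F _) -/(F x) E.
by have [_ ->] := dF (x + a *: e_ i); rewrite E'.
Qed.

(* Both second derivatives are limits of the same second difference, by the
   mean value theorem. *)
Lemma schwarz u x i j : smooth u ->
  partial i (partial j u) x = partial j (partial i u) x.
Proof.
move=> su.
have ci : continuous (partial i (partial j u)) by have [] := su [:: i; j].
have cj : continuous (partial j (partial i u)) by have [] := su [:: j; i].
(* Both points differ from [x] by at most 2h in each coordinate; the radius 3h leaves room for the
   strict inequality in the definition of the ball. *)
have H (h : R) : 0 < h -> exists p q, [/\ ball x (h *+ 3) p, ball x (h *+ 3) q &
    partial i (partial j u) p = partial j (partial i u) q].
  move=> h0.
  have [a [b [ha hb E]]] := mixed_difference x h0 (fun y => (su [::]).2 i y)
     (fun y => (su [:: i]).2 j y).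
  have [a' [b' [ha' hb' E']]] := mixed_difference x h0 (fun y => (su [::]).2 j y)
     (fun y => (su [:: j]).2 i y).
  have near (c d : R) (k l : 'I_3) : 0 <= c <= h -> 0 <= d <= h ->
      ball x (h *+ 3) (x + c *: e_ k + d *: e_ l).
    move=> /andP[c0 ch] /andP[d0 dh]; apply/ball3P => m.
    rewrite !pcoordD !pcoordZ !pcoord_basis.
    rewrite (_ : _ - _ = - (c * (m == k)%:R + d * (m == l)%:R)); last by ring.
    rewrite normrN ger0_norm ?addr_ge0 ?mulr_ge0 //.
    apply: (@le_lt_trans _ _ (h + h)).
      by apply: lerD; [rewrite (le_trans _ ch)|rewrite (le_trans _ dh)] => //;
        rewrite ler_piMr // lern1 leq_b1.
    by rewrite (_ : _ *+ 3 = h + h + h) ?ltrDl // !mulrS mulr0n; ring.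
  exists (x + a' *: e_ j + b' *: e_ i), (x + a *: e_ i + b *: e_ j); split; try exact: near.
  have hn0 : h != 0 by rewrite gt_eqF.
  have L (r1 r2 r3 r4 : R) : r1 - r2 - (r3 - r4) = r1 - r3 - (r2 - r4) by ring.
  move: E'; rewrite L [x + h *: e_ j + _]addrAC E => /(mulfI hn0)/(mulfI hn0) ->.
  by [].
apply/eqP; apply: contraT => ne.
pose e := `|partial i (partial j u) x - partial j (partial i u) x| / 2.
have e0 : 0 < e by rewrite divr_gt0 // normr_gt0 subr_eq0.
have /cvgrPdist_lt/(_ e e0)/nbhs_ballP[d1 /= d10 b1] := ci x.
have /cvgrPdist_lt/(_ e e0)/nbhs_ballP[d2 /= d20 b2] := cj x.
pose d := Num.min d1 d2.
have d0 : 0 < d by rewrite lt_min d10 d20.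
have [p [q [bp bq E]]] := H (d / 3) (divr_gt0 d0 (ltr0Sn _ 2)).
have E3 : (d / 3) *+ 3 = d by rewrite -[_ *+ 3]mulr_natr divfK.
rewrite E3 in bp bq.
have dd1 : d <= d1 by rewrite ge_min lexx.
have dd2 : d <= d2 by rewrite ge_min lexx orbT.
have h1 := b1 p (le_ball dd1 bp).
have h2 := b2 q (le_ball dd2 bq).
rewrite /= E in h1.
have key (A B P : R) : `|A - P| < e -> `|B - P| < e -> `|A - B| < e + e.
  move=> hA hB; have -> : A - B = (A - P) - (B - P) by ring.
  exact: le_lt_trans (ler_normB _ _) (ltrD hA hB).
have := key _ _ _ h1 h2.
by rewrite /e -splitr ltxx.
Qed.

Lemma partial_smooth u i : smooth u -> smooth (partial i u).
Proof. by move=> su s; rewrite -foldr_rcons; exact: su. Qed.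

Lemma partial_eq0 u i (C : set (pt3 R)) : closed C -> (forall x, ~ C x -> u x = 0) ->
  forall x, ~ C x -> partial i u x = 0.
Proof.
move=> cC u0 x nCx; rewrite /partial -(@derive_cst _ _ R (0 : R) x (e_ i)).
apply: near_eq_derive; have : open (~` C) by exact: closed_openC.
by rewrite openE => /(_ x nCx); apply: filterS => y /u0.
Qed.

Lemma test_fun_partial U u i : test_fun U u -> test_fun U (partial i u).
Proof.
move=> [su [C [cC CU u0]]]; split; first exact: partial_smooth.
exists C; split=> //; apply: partial_eq0 u0.
by apply: compact_closed cC; exact: norm_hausdorff.
Qed.

Lemma comp_grad u i : Defs.comp (grad u) i = partial i u.
Proof. by apply/funext => x; rewrite /Defs.comp mxE. Qed.

Lemma test_field_grad U u : test_fun U u -> test_field U (grad u).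
Proof. by move=> tu i; rewrite comp_grad; exact: test_fun_partial. Qed.

Lemma curl_grad u x : smooth u -> curl (grad u) x = 0.
Proof.
move=> su; apply/matrixP => i j; rewrite !mxE !comp_grad.
by rewrite schwarz ?subrr.
Qed.

(** The gradient of a test function is itself a test field, hence admissible in the definition of
    the weak curl. *)
Lemma weak_div_weak_curl (Omega : set (pt3 R)) v w :
  is_weak_curl Omega v w -> is_weak_div Omega w (fun=> 0).
Proof.
move=> vw phi tphi; rewrite vw; last exact: test_field_grad.
have E : (fun x => dot (v x) (curl (grad phi) x)) = fun=> 0.
  apply/funext => x; rewrite (curl_grad x tphi.1) /dot big1 // => i _.
  by rewrite mxE mulr0.
rewrite /ip E; under eq_Rintegral do rewrite mul0r.
by rewrite /Rintegral integral0 /= oppr0.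
Qed.

End schwarz.

(** * Integrals of partial derivatives *)

Section leb2.
Context {R : realType}.
Local Notation leb := (@lebesgue_measure R).

(* A named copy: on the product itself, the sigma-finite structure that
   inference finds is the one for subprobabilities. *)
Definition leb2 : set (measurableTypeR R * measurableTypeR R)%type -> \bar R :=
  (leb \x leb)%E.

HB.instance Definition _ := Measure.copy leb2 (leb \x leb)%E.

Lemma leb2_square_lty (L : R) : (leb2 (`[(- L)%R, L%R]%classic `*` `[(- L)%R, L%R]%classic) < +oo)%E.
Proof.
rewrite /leb2 product_measure1E //.
have fin : leb `[- L, L]%classic \is a fin_num.
  by rewrite /= lebesgue_measure_itv /=; case: ifP.
by rewrite ltey_eq fin_numM ?orbT.
Qed.

Let leb2_sigma_finite : sigma_finite setT leb2.
Proof.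
exists (fun n => `[- (n%:R : R), n%:R]%classic `*` `[- (n%:R : R), n%:R]%classic).
  apply/seteqP; split=> // -[x y] _.
  exists (Num.bound (`|x| + `|y|)) => //.
  have h : `|x| + `|y| < (Num.bound (`|x| + `|y|))%:R by apply: archi_boundP.
  by split; rewrite /= in_itv /= -ler_norml (le_trans _ (ltW h)) ?lerDl ?lerDr.
move=> n; split; last exact: leb2_square_lty.
by apply: measurableX; exact: measurable_itv.
Qed.

HB.instance Definition _ := Measure_isSigmaFinite.Build _ _ _ leb2 leb2_sigma_finite.

End leb2.

Section integral_partial.
Context {R : realType}.
Local Notation e_ i := (@Defs.basis R i).
Local Notation leb := (@lebesgue_measure R).
Local Notation mu := (@leb3 R).

(** The fundamental theorem on [-L, L]; the case of equality in the hypothesis on [F] makes both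
    boundary values zero. *)
Lemma integral_derive0 (f F : R -> R) (L : R) : 0 < L ->
  (forall t : R, is_derive t (1 : R) F (f t)) -> continuous f ->
  (forall t, L <= `|t| -> F t = 0) -> (forall t, L <= `|t| -> f t = 0) ->
  (\int[leb]_t (f t)%:E = 0)%E.
Proof.
move=> L0 dF cf F0 f0.
have NL : - L < L by rewrite gtrN.
pose I := `[- L, L]%classic.
transitivity (\int[leb]_(t in I) (f t)%:E)%E.
  rewrite [RHS]integral_mkcond; apply: eq_integral => t _; rewrite patchE.
  case: ifPn => // /negP tL; rewrite f0 // leNgt; apply/negP => tL'.
  apply: tL; apply/mem_set; rewrite /I /= in_itv /=.
  by rewrite -ler_norml ltW.
have cF : continuous F by move=> t; exact: is_derive_continuous (dF t).
rewrite (@continuous_FTC2 _ f F) //.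
- by rewrite !F0 ?subee // ?normrN ger0_norm // ltW.
- exact: continuous_subspaceT.
- split; [by move=> t _; have [] := dF t| |].
  + by apply: cvg_at_right_filter; exact: cF.
  + by apply: cvg_at_left_filter; exact: cF.
- by move=> t _; rewrite derive1E; have [] := dF t.
Qed.

Lemma compact_support_bounded (g : pt3 R -> R) (C : set (pt3 R)) : compact C ->
  continuous g -> (forall x, ~ C x -> g x = 0) -> exists M, forall x, `|g x| <= M.
Proof.
move=> cC cg g0; have [M HM] := compact_bound cC cg.
exists `|M| => x; have [Cx|nCx] := pselect (C x); last by rewrite g0 // normr0.
by rewrite (le_trans (HM _ Cx)) // ler_norm.
Qed.

Section integral_partial0.
Variables (psi : pt3 R -> R) (i : 'I_3) (C : set (pt3 R)).
Hypotheses (cC : compact C) (psiC : forall x, ~ C x -> psi x = 0).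
Hypotheses (dpsi : forall x, derivable psi x (e_ i)) (cg : continuous (partial i psi)).
Let g := partial i psi.

Let gC x : ~ C x -> g x = 0.
Proof.
apply: partial_eq0 psiC x; apply: compact_closed cC; exact: norm_hausdorff.
Qed.

Let bigL : exists2 L, 0 < L & forall x j, L <= `|pcoord j x| -> ~ C x.
Proof.
have [a [b Cab]] := bounded_cbox (compact_bounded cC).
(* The sum dominates every coordinate of a point of the box around [C]; adding 1 makes the bound
   strict. *)
pose L := \sum_j (`|pcoord j a| + `|pcoord j b|) + 1.
have S0 : 0 <= \sum_j (`|pcoord j a| + `|pcoord j b|) :> R.
  by apply: sumr_ge0 => j _; rewrite addr_ge0.
exists L; first by rewrite /L ltr_pwDr.
move=> x j Lx /Cab /(_ j) /andP[h1 h2].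
have : `|pcoord j x| <= `|pcoord j a| + `|pcoord j b|.
  rewrite ler_norml; apply/andP; split.
    rewrite lerNl; apply: (@le_trans _ _ (- pcoord j a)); first by rewrite lerN2.
    by rewrite (le_trans (ler_norm _)) // normrN lerDl.
  by rewrite (le_trans h2) // (le_trans (ler_norm _)) // lerDr.
have : `|pcoord j a| + `|pcoord j b| <= \sum_j (`|pcoord j a| + `|pcoord j b|).
  by rewrite [leRHS](bigD1 j) //= lerDl sumr_ge0 // => k _; rewrite addr_ge0.
by move: Lx; rewrite /L; lra.
Qed.

(** With the base point on the plane where coordinate [i] is 0, the parameter [t] is that coordinate
    itself, so the line is outside [C] for large values of [t]. *)
Let line0 x0 : pcoord i x0 = 0 -> (\int[leb]_t (g (x0 + t *: e_ i))%:E = 0)%E.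
Proof.
move=> xi0; have [L L0 HL] := bigL.
have pt0 (t : R) : L <= `|t| -> ~ C (x0 + t *: e_ i).
  move=> Lt; apply: (HL _ i).
  by rewrite pcoordD pcoordZ pcoord_basis eqxx mulr1 xi0 add0r.
have dF (t : R) : is_derive t (1 : R) (fun s : R => psi (x0 + s *: e_ i)) (g (x0 + t *: e_ i)).
  exact: (is_derive_slice psi x0 (e_ i) t _).1 (derivableP (@dpsi _)).
have cF : continuous (fun t : R => g (x0 + t *: e_ i)).
  move=> t; apply: continuous_comp; last exact: cg.
  by apply: cvgD; [exact: cvg_cst|apply: scalel_continuous].
exact: (integral_derive0 L0 dF cF (fun t h => psiC (pt0 t h)) (fun t h => gC (pt0 t h))).
Qed.

Lemma compact_support_integrable (f : pt3 R -> R) : continuous f ->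
  (forall x, ~ C x -> f x = 0) -> mu.-integrable setT (EFin \o f).
Proof.
move=> cf f0; have [M HM] := compact_support_bounded cC cf f0.
have [a [b Cab]] := bounded_cbox (compact_bounded cC).
have mb := measurable_cbox a b.
have mf := continuous_measurable3 cf.
rewrite (_ : EFin \o f = (EFin \o f) \_ (cbox a b)); last first.
  apply/funext => x; rewrite patchE; case: ifPn => // /negP xb.
  by rewrite /= f0 // => /Cab ?; apply: xb; exact/mem_set.
apply/(integrable_mkcond _ mb).
apply: measurable_bounded_integrable => //.
- exact: leb3_cbox_lty.
- exact: (measurable_funS measurableT).
- by exists M; split; [exact: num_real|move=> M' MM' x _ /=; rewrite (le_trans (HM x)) // ltW].
Qed.

(** By Fubini, with direction [i] integrated innermost. Since [leb3] is nested as a product of a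
    plane and a line, direction 2 takes one application, and directions 0 and 1 take a second one in
    the plane. *)
Lemma integral_partial0 : (\int[mu]_x (partial i psi x)%:E = 0)%E.
Proof.
have intg := compact_support_integrable cg gC.
have mg := continuous_measurable3 cg.
have [L L0 HL] := bigL.
have [M HM] := compact_support_bounded cC cg gC.
have gL x j : L <= `|pcoord j x| -> g x = 0 by move=> h; apply: gC; exact: (HL x j).
(* The second application of Fubini happens at fixed [z], and needs integrability of that slice. *)
have intz (z : R) : (leb \x leb)%E.-integrable setT (fun p => (g (p, z))%:E).
  pose S : set (measurableTypeR R * measurableTypeR R) := `[- L, L]%classic `*` `[- L, L]%classic.
  have mS : measurable S by apply: measurableX; exact: measurable_itv.
  rewrite (_ : (fun p => _) = (fun p => (g (p, z))%:E) \_ S); last first.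
    apply/funext => p; rewrite patchE; case: ifPn => // /negP pS.
    have [p1|p1] := leP L `|p.1|.
      by rewrite (gL _ 0) // pcoordE.
    have [p2|p2] := leP L `|p.2|.
      by rewrite (gL _ 1) // pcoordE.
    by exfalso; apply: pS; apply/mem_set; split; rewrite /= in_itv /= -ler_norml ltW.
  apply/(integrable_mkcond _ mS).
  pose G2 : (measurableTypeR R * measurableTypeR R) -> R := fun p => g (p, z).
  apply: (@measurable_bounded_integrable _ _ _ _ G2 _ mS) => //.
  - exact: leb2_square_lty.
  - apply: (measurable_funS measurableT) => //.
    exact: (measurable_fun_pair1 (f := g : mpt3 R -> measurableTypeR R)).
  - by exists M; split; [exact: num_real|move=> M' MM' x _ /=; rewrite (le_trans (HM _)) // ltW].
have lineE x0 (f : R -> pt3 R) : pcoord i x0 = 0 -> (forall t, f t = x0 + t *: e_ i) ->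
    (\int[leb]_t (g (f t))%:E = 0)%E.
  by move=> h /funext ->; exact: line0.
have [i2|i2] := eqVneq i 2.
  apply: etrans (esym (@integral12_prod_meas1 _ _ _ _ _ (@leb2 R) leb (EFin \o g) intg)) _.
  apply: integral0_eq => p _.
  apply: (lineE (p, 0) (fun t => (p, t))); first by rewrite i2 pcoordE.
  move=> t; apply: pcoord_inj => j; rewrite pcoordD pcoordZ pcoord_basis i2.
  by elim/ord3_ind: j; rewrite !pcoordE /= ?mulr0 ?mulr1 ?addr0 ?add0r.
apply: etrans (esym (@integral21_prod_meas1 _ _ _ _ _ (@leb2 R) leb (EFin \o g) intg)) _.
apply: integral0_eq => z _.
rewrite /fubini_G /=.
have [i1|i1] := eqVneq i 1.
  apply: etrans (esym (@integral12_prod_meas1 _ _ _ _ _ leb leb (fun p => (g (p, z))%:E) (intz z))) _.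
  apply: integral0_eq => x _.
  apply: (lineE (x, 0, z) (fun t => (x, t, z))); first by rewrite i1 pcoordE.
  move=> t; apply: pcoord_inj => j; rewrite pcoordD pcoordZ pcoord_basis i1.
  by elim/ord3_ind: j; rewrite !pcoordE /= ?mulr0 ?mulr1 ?addr0 ?add0r.
have i0 : i = 0 by move: i1 i2; elim/ord3_ind: (i).
apply: etrans (esym (@integral21_prod_meas1 _ _ _ _ _ leb leb (fun p => (g (p, z))%:E) (intz z))) _.
apply: integral0_eq => y _.
apply: (lineE (0, y, z) (fun t => (t, y, z))); first by rewrite i0 pcoordE.
move=> t; apply: pcoord_inj => j; rewrite pcoordD pcoordZ pcoord_basis i0.
by elim/ord3_ind: j; rewrite !pcoordE /= ?mulr0 ?mulr1 ?addr0 ?add0r.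
Qed.

End integral_partial0.

End integral_partial.

(** * Tetrahedra and polynomials *)

Section tetra.
Context {R : realType}.

Lemma sum3 (F : 'I_3 -> R) : \sum_i F i = F 0 + F 1 + F 2.
Proof.
rewrite !big_ord_recl big_ord0 addr0 addrA.
by congr (_ + F _ + F _); exact: val_inj.
Qed.

(** Row i is 1 followed by the vertex [a i], so that a product with a row of weights yields their
    sum and the weighted point together, and affine independence becomes triviality of the left
    kernel. *)
Definition affine_mx (a : 'I_4 -> 'cV[R]_3) : 'M[R]_(4, 1 + 3) :=
  row_mx (const_mx 1) (\matrix_i (a i)^T).

Lemma mul_affine_mx (a : 'I_4 -> 'cV[R]_3) (t : 'rV[R]_4) :
  t *m affine_mx a = row_mx (\sum_i t 0 i)%:M (\sum_i t 0 i *: a i)^T.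
Proof.
rewrite mul_mx_row; congr row_mx.
  apply/matrixP => i j; rewrite !ord1 !mxE eqxx mulr1n.
  by apply: eq_bigr => k _; rewrite mxE mulr1.
rewrite mulmx_sum_row linear_sum /=; apply: eq_bigr => i _.
by rewrite linearZ /= rowK.
Qed.

Lemma affine_mx_unit (a : 'I_4 -> 'cV[R]_3) : affinely_independent a ->
  (affine_mx a : 'M[R]_4) \in unitmx.
Proof.
move=> ha; rewrite -row_free_unit; apply: inj_row_free => t.
move=> E; have : t *m affine_mx a = row_mx 0 0 by rewrite row_mx0.
rewrite mul_affine_mx => /eq_row_mx [h1 h2].
apply/rowP => i; rewrite mxE; apply: (ha (fun i => t 0 i)).
  by move/matrixP: h1 => /(_ 0 0); rewrite !mxE eqxx mulr1n.
by apply: trmx_inj; rewrite h2 trmx0.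
Qed.

(* Row vector of the barycentric coordinates of x: the solution t of
   sum t_i = 1, sum t_i a_i = x. *)
Definition barycentric (a : 'I_4 -> 'cV[R]_3) (x : pt3 R) : 'rV[R]_4 :=
  (row_mx 1%:M (vec x)^T : 'rV[R]_4) *m invmx (affine_mx a : 'M[R]_4).

(** Invertibility makes the weights unique, so the existence of positive weights turns into
    positivity of four continuous functions of [x], an open condition. *)
Lemma open_tetraE (a : 'I_4 -> 'cV[R]_3) : affinely_independent a ->
  open_tetra a = [set x | forall i, 0 < barycentric a x 0 i].
Proof.
move=> ha; have u := affine_mx_unit ha; apply/seteqP; split=> x /=.
  move=> [t [t0 t1 tx]] i; rewrite (_ : barycentric a x = \row_i t i) ?mxE //.
  have E : row_mx 1%:M (vec x)^T = (\row_i t i) *m affine_mx a.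
    rewrite mul_affine_mx; congr row_mx.
      by congr (_ %:M); rewrite -t1; apply: eq_bigr => j _; rewrite mxE.
    by rewrite tx; congr trmx; apply: eq_bigr => j _; rewrite mxE.
  by rewrite /barycentric E; exact: (mulmxK u).
move=> h; exists (fun i => barycentric a x 0 i).
have : barycentric a x *m affine_mx a = row_mx 1%:M (vec x)^T by rewrite mulmxKV.
rewrite mul_affine_mx => /eq_row_mx [h1 h2]; split => //.
  by move/matrixP: h1 => /(_ 0 0); rewrite !mxE eqxx !mulr1n.
by apply: trmx_inj; rewrite h2.
Qed.

Lemma barycentric_continuous (a : 'I_4 -> 'cV[R]_3) i :
  continuous (fun x => barycentric a x 0 i).
Proof.
pose M : 'M[R]_(1 + 3, 4) := invmx (affine_mx a : 'M[R]_4).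
rewrite (_ : (fun x => _) = (fun x => M (lshift 3 0) i +
  (pcoord 0 x * M (rshift 1 0) i + pcoord 1 x * M (rshift 1 1) i
   + pcoord 2 x * M (rshift 1 2) i))).
  move=> x; apply: cvgD; first exact: cvg_cst.
  by apply: cvgD; [apply: cvgD|]; apply: cvgM; try exact: cvg_cst; exact: pcoord_continuous.
have E (w : 'rV[R]_(1 + 3)) : (w *m M) 0 i = w 0 (lshift 3 0) * M (lshift 3 0) i +
    (w 0 (rshift 1 0) * M (rshift 1 0) i + w 0 (rshift 1 1) * M (rshift 1 1) i
     + w 0 (rshift 1 2) * M (rshift 1 2) i).
  by rewrite mxE big_split_ord /= big_ord1 sum3.
apply/funext => x; apply: (etrans (E (row_mx 1%:M (vec x)^T))).
by rewrite row_mxEl !row_mxEr mxE eqxx mul1r ![(_^T) _ _]mxE.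
Qed.

Lemma open_open_tetra (a : 'I_4 -> 'cV[R]_3) : affinely_independent a ->
  open (open_tetra a).
Proof.
move=> ha; rewrite open_tetraE // openE => x /= h.
have H i : \forall y \near x, 0 < barycentric a y 0 i.
  have c := @barycentric_continuous a i x.
  by apply: (c [set t | 0 < t]); exact: lt_nbhsr.
exact: (@filter_forall _ _ (fun i y => 0 < barycentric a y 0 i) _ _ H).
Qed.

End tetra.

Section poly.
Context {R : realType}.
Local Notation e_ i := (@Defs.basis R i).
Implicit Types (u v : pt3 R -> R) (k : nat).

Definition mono (a b c : nat) (x : pt3 R) : R := x.1.1 ^+ a * x.1.2 ^+ b * x.2 ^+ c.

Lemma poly_of_degreeD P k u v : poly_of_degree P k u -> poly_of_degree P k v ->
  poly_of_degree P k (fun x => u x + v x).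
Proof.
move=> [c hc] [d hd]; exists (fun i j l => c i j l + d i j l) => x.
rewrite hc hd -big_split; apply: eq_bigr => i _; rewrite -big_split.
apply: eq_bigr => j _; rewrite -big_split; apply: eq_bigr => l _ /=.
by rewrite mulrDl.
Qed.

Lemma poly_of_degreeZ P k a u : poly_of_degree P k u ->
  poly_of_degree P k (fun x => a * u x).
Proof.
move=> [c hc]; exists (fun i j l => a * c i j l) => x.
rewrite hc mulr_sumr; apply: eq_bigr => i _; rewrite mulr_sumr.
apply: eq_bigr => j _; rewrite mulr_sumr; apply: eq_bigr => l _ /=.
by rewrite mulrA.
Qed.

Lemma Pk_mono k a b c : (a + b + c <= k)%N -> Pk k (mono a b c).
Proof.
move=> h.
have ha : (a < k.+1)%N by rewrite ltnS (leq_trans _ h) // -addnA leq_addr.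
have hb : (b < k.+1)%N by rewrite ltnS (leq_trans _ h) // addnAC leq_addl.
have hc : (c < k.+1)%N by rewrite ltnS (leq_trans _ h) // leq_addl.
exists (fun i j l => ((i == a) && (j == b) && (l == c))%:R) => x.
rewrite (bigD1 (Ordinal ha)) //= (bigD1 (Ordinal hb)) //= (bigD1 (Ordinal hc)) //=.
rewrite !eqxx mul1r big1 ?addr0 => [|l /andP[_ /negPf nl]]; last first.
  by rewrite (_ : (l == c :> nat) = false) ?andbF ?mul0r // -nl.
rewrite big1 ?addr0 => [|j /negPf nj]; last first.
  by apply: big1 => l _; rewrite (_ : (j == b :> nat) = false) ?mul0r // -nj.
rewrite big1 ?addr0 // => i /negPf ni.
apply: big1 => j _; apply: big1 => l _.
by rewrite (_ : (i == a :> nat) = false) ?mul0r // -ni.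
Qed.

Lemma Pk0 k : @Pk R k (fun=> 0).
Proof.
exists (fun _ _ _ => 0) => x; rewrite big1 // => i _; rewrite big1 // => j _.
by rewrite big1 // => l _; rewrite mul0r.
Qed.

Lemma mono_prod3 a b c : mono a b c =
  prod3 (fun i t => t ^+ (if i == 0 then a else if i == 1 then b else c)).
Proof. by apply/funext => x; rewrite /prod3 /mono !pcoordE. Qed.

Lemma mono_continuous a b c : continuous (mono a b c).
Proof.
rewrite mono_prod3 => x.
have h (i : 'I_3) (n : nat) : (fun x => pcoord i x ^+ n) @ x --> pcoord i x ^+ n.
  apply: (@continuous_comp _ _ _ (pcoord i) (fun t : R => t ^+ n)).
    exact: pcoord_continuous.
  exact: exprn_continuous.
by apply: cvgM; [apply: cvgM|]; exact: h.
Qed.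

(* Contains P_k and the homogeneous polynomials of degree k + 1. *)
Definition C1poly k u :=
  continuous u /\ forall i, (forall x, derivable u x (e_ i)) /\ Pk k (partial i u).

Lemma C1poly_mono k a b c : (a + b + c <= k.+1)%N -> C1poly k (mono a b c).
Proof.
move=> h; split; first exact: mono_continuous.
have d x i := @partial_prod3 R (fun i t => t ^+ (if i == 0 then a else if i == 1 then b else c))
  (fun i t => (if i == 0 then a else if i == 1 then b else c)%:R *
     t ^+ (if i == 0 then a else if i == 1 then b else c).-1) x i.
have de (n : nat) (t : R) : is_derive t (1 : R) (fun t : R => t ^+ n) (n%:R * t ^+ n.-1).
  split; first exact: exprn_derivable.
  by rewrite exp_derive /GRing.scale /= mulr1.
have {}d x i := d x i (fun j t => de _ _).
move=> i; split; first by move=> x; rewrite mono_prod3; have [] := d x i.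
have -> : partial i (mono a b c) = prod3 (fun i0 => if i0 == i
         then fun t => (if i0 == 0 then a else if i0 == 1 then b else c)%:R *
              t ^+ (if i0 == 0 then a else if i0 == 1 then b else c).-1
         else fun t => t ^+ (if i0 == 0 then a else if i0 == 1 then b else c)).
  by apply/funext => x; rewrite /partial mono_prod3; have [_ ->] := d x i.
elim/ord3_ind: i.
- rewrite (_ : prod3 _ = fun x => a%:R * mono a.-1 b c x).
    (* When the exponent is 0 its truncated predecessor does not lower the degree, but the
       coefficient vanishes. *)
    case: a h {d} => [|a] h; last by apply: poly_of_degreeZ; apply: Pk_mono.
    by under eq_fun do rewrite mul0r; exact: Pk0.
  by apply/funext => x; rewrite /prod3 /mono !pcoordE /= -!mulrA.
- rewrite (_ : prod3 _ = fun x => b%:R * mono a b.-1 c x).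
    case: b h {d} => [|b] h; last by apply: poly_of_degreeZ; apply: Pk_mono; move: h; rewrite addnS addSn.
    by under eq_fun do rewrite mul0r; exact: Pk0.
  by apply/funext => x; rewrite /prod3 /mono !pcoordE /=; ring.
- rewrite (_ : prod3 _ = fun x => c%:R * mono a b c.-1 x).
    case: c h {d} => [|c] h; last by apply: poly_of_degreeZ; apply: Pk_mono; move: h; rewrite addnS.
    by under eq_fun do rewrite mul0r; exact: Pk0.
  by apply/funext => x; rewrite /prod3 /mono !pcoordE /=; ring.
Qed.

Lemma C1poly_add k u v : C1poly k u -> C1poly k v -> C1poly k (fun x => u x + v x).
Proof.
move=> [cu du] [cv dv]; split; first by move=> x; apply: cvgD; [exact: cu|exact: cv].
have d x i : is_derive x (e_ i) (fun x => u x + v x) (partial i u x + partial i v x).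
  exact: is_deriveD (derivableP ((du i).1 x)) (derivableP ((dv i).1 x)).
move=> i; split; first by move=> x; have [] := d x i.
rewrite (_ : partial i _ = fun x => partial i u x + partial i v x).
  exact: poly_of_degreeD (du i).2 (dv i).2.
by apply/funext => x; have [_] := d x i.
Qed.

Lemma C1poly_scale k a u : C1poly k u -> C1poly k (fun x => a * u x).
Proof.
move=> [cu du]; split; first by move=> x; apply: cvgM; [exact: cvg_cst|exact: cu].
have d x i : is_derive x (e_ i) (fun x => a * u x) (a * partial i u x).
  exact: is_deriveZ (derivableP ((du i).1 x)).
move=> i; split; first by move=> x; have [] := d x i.
rewrite (_ : partial i _ = fun x => a * partial i u x).
  exact: poly_of_degreeZ (du i).2.
by apply/funext => x; have [_] := d x i.
Qed.

Lemma C1poly0 k : C1poly k (fun=> 0).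
Proof.
have := @C1poly_scale k 0 (mono 0 0 0) (@C1poly_mono k 0 0 0 isT).
by under eq_fun do rewrite mul0r.
Qed.

Lemma C1poly_sum k (I : finType) (P : pred I) (F : I -> pt3 R -> R) :
  (forall i, P i -> C1poly k (F i)) -> C1poly k (fun x => \sum_(i | P i) F i x).
Proof.
move=> h; elim: (index_enum I) => [|i r IH].
  by under eq_fun do rewrite big_nil; exact: C1poly0.
case Pi : (P i); under eq_fun do rewrite big_cons Pi; last by [].
by apply: C1poly_add => //; exact: h.
Qed.

(** The bound [k'] on the exponents is kept apart from [k], because P_k is written with exponents up
    to k and the homogeneous part of a Nedelec field with exponents up to k + 1. *)
Lemma C1poly_of_degree k k' (P : pred nat) u : (forall m, P m -> (m <= k.+1)%N) ->
  poly_of_degree P k' u -> C1poly k u.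
Proof.
move=> hP [c hc]; rewrite (_ : u = fun x => \sum_(i < k'.+1) \sum_(j < k'.+1)
   \sum_(l < k'.+1 | P (i + j + l)%N) c i j l * mono i j l x); last exact/funext.
apply: C1poly_sum => i _; apply: C1poly_sum => j _; apply: C1poly_sum => l Pl.
by apply: C1poly_scale; apply: C1poly_mono; exact: hP.
Qed.

Lemma Pk_C1poly k u : Pk k u -> C1poly k u.
Proof. by apply: C1poly_of_degree => m; exact: leqW. Qed.

Lemma Pk_continuous k u : Pk k u -> continuous u.
Proof. by move=> /Pk_C1poly[]. Qed.

Lemma nedelec_C1poly k (v : pt3 R -> 'cV[R]_3) i : nedelec k v -> C1poly k (Defs.comp v i).
Proof.
move=> [p [q [hp hq _ hv]]].
rewrite (_ : Defs.comp v i = fun x => Defs.comp p i x + Defs.comp q i x).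
  by apply: C1poly_add; [exact: Pk_C1poly|apply: C1poly_of_degree (hq i) => m /eqP ->].
by apply/funext => x; rewrite /Defs.comp hv mxE.
Qed.

Lemma C1poly_curl k (v : pt3 R -> 'cV[R]_3) i : (forall i, C1poly k (Defs.comp v i)) ->
  Pk k (Defs.comp (curl v) i).
Proof.
move=> hv; rewrite (_ : Defs.comp (curl v) i = fun x =>
  partial (i + 1) (Defs.comp v (i + 2)) x + (-1) * partial (i + 2) (Defs.comp v (i + 1)) x).
  apply: poly_of_degreeD; first exact: ((hv (i + 2)).2 _).2.
  by apply: poly_of_degreeZ; exact: ((hv (i + 1)).2 _).2.
by apply/funext => x; rewrite /Defs.comp mxE mulN1r.
Qed.

Lemma raviart_thomas_Pk k (v : pt3 R -> 'cV[R]_3) : (forall i, Pk k (Defs.comp v i)) ->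
  raviart_thomas k v.
Proof.
move=> hv; exists v, (fun=> 0); split => //; last by move=> x; rewrite scale0r addr0.
exists (fun _ _ _ => 0) => x; rewrite big1 // => i _; rewrite big1 // => j _.
by rewrite big1 // => l _; rewrite mul0r.
Qed.

End poly.

(** * Weak curl and weak divergence *)

Section L2v.
Context {R : realType}.
Local Notation mu := (@leb3 R).
Local Notation e_ i := (@Defs.basis R i).
Variable Omega : set (pt3 R).
Hypotheses (oO : open Omega) (bO : bounded_set Omega).
Implicit Types (u d phi : pt3 R -> R) (v w : pt3 R -> 'cV[R]_3).

Let mO : measurable (Omega : set (mpt3 R)) := open_measurable3 oO.
Let finO : (mu Omega < +oo)%E := bounded_lty mO bO.

Lemma Rintegral_support (K : set (pt3 R)) (f : pt3 R -> R) : K `<=` Omega ->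
  (forall x, Omega x -> ~ K x -> f x = 0) ->
  \int[mu]_(x in Omega) f x = \int[mu]_(x in K) f x.
Proof.
move=> KO f0; rewrite Rintegral_mkcond [RHS]Rintegral_mkcond; congr Rintegral.
apply/funext => x; rewrite !patchE; case: ifPn => [/set_mem Ox|/negP nO].
  by case: ifPn => // /negP nK; rewrite f0 // => Kx; apply: nK; exact/mem_set.
by rewrite ifF //; apply/negP => /set_mem /KO Ox; apply: nO; exact/mem_set.
Qed.

Lemma L2_continuous_bounded (K : set (pt3 R)) (f : pt3 R -> R) : open K -> K `<=` Omega ->
  continuous f -> L2 K f.
Proof.
move=> oK KO cf; have mK := open_measurable3 oK.
have [a [b Kab]] := bounded_cbox bO.
have [M HM] := compact_bound (compact_cbox (a := a) (b := b)) cf.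
apply: (@L2_bounded _ _ mK _ M).
- by apply: le_lt_trans finO; apply: le_measure => //; rewrite inE.
- by apply: (measurable_funS measurableT) => //; exact: continuous_measurable3.
- by move=> x Kx; apply: HM; apply: Kab; exact: KO.
Qed.

Lemma L2_test phi : test_fun Omega phi -> L2 Omega phi.
Proof.
by move=> h; apply: L2_continuous_bounded => //; exact: test_fun_continuous h.
Qed.

Lemma L2v_grad phi : test_fun Omega phi -> L2v Omega (grad phi).
Proof.
by move=> h i; rewrite comp_grad; apply: L2_test; exact: test_fun_partial.
Qed.

Lemma comp_curl v i : Defs.comp (curl v) i =
  fun x => partial (i + 1) (Defs.comp v (i + 2)) x - partial (i + 2) (Defs.comp v (i + 1)) x.
Proof. by apply/funext => x; rewrite /Defs.comp mxE. Qed.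

Lemma L2v_curl w : test_field Omega w -> L2v Omega (curl w).
Proof.
move=> h i; rewrite comp_curl; apply: L2_sub => //; apply: L2_test;
  by apply: test_fun_partial; exact: h.
Qed.

(** The form with two coefficients, kept throughout, covers [delta_t], [midpoint] and the sum of the
    two terms of the second equation. *)
Lemma L2v_lin a b v w : L2v Omega v -> L2v Omega w ->
  L2v Omega (fun x => a *: v x + b *: w x).
Proof.
move=> hv hw i.
rewrite (_ : Defs.comp _ i = fun x => a * Defs.comp v i x + b * Defs.comp w i x).
  by apply: L2_add => //; apply: L2_scale.
by apply/funext => x; rewrite /Defs.comp !mxE.
Qed.

Lemma dotE (a b : 'cV[R]_3) : dot a b = a 0 0 * b 0 0 + a 1 0 * b 1 0 + a 2 0 * b 2 0.
Proof. exact: sum3. Qed.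

Lemma dot_integrable v w : L2v Omega v -> L2v Omega w ->
  mu.-integrable Omega (fun x => (dot (v x) (w x))%:E).
Proof.
move=> hv hw.
have h i := L2_mul_integrable mO (hv i) (hw i).
have := integrableD mO (integrableD mO (h 0) (h 1)) (h 2).
by apply: eq_integrable => // x _ /=; rewrite dotE.
Qed.

Lemma ip_lin a b v w z : L2v Omega v -> L2v Omega w -> L2v Omega z ->
  ip Omega (fun x => a *: v x + b *: w x) z = a * ip Omega v z + b * ip Omega w z.
Proof.
move=> hv hw hu; have iv := dot_integrable hv hu; have iw := dot_integrable hw hu.
rewrite /ip -!RintegralZl // -RintegralD //.
- by apply: eq_Rintegral => x _; rewrite !dotE !mxE; ring.
- exact: (integrableZl mO a iv).
- exact: (integrableZl mO b iw).
Qed.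

Lemma weak_curl_lin a b v v' w w' : L2v Omega v -> L2v Omega v' ->
  L2v Omega w -> L2v Omega w' ->
  is_weak_curl Omega v w -> is_weak_curl Omega v' w' ->
  is_weak_curl Omega (fun x => a *: v x + b *: v' x) (fun x => a *: w x + b *: w' x).
Proof.
move=> hv hv' hw hw' h h' phi tphi.
have lphi : L2v Omega phi by move=> i; apply: L2_test; exact: tphi.
by rewrite !ip_lin //; [rewrite h // h'|exact: L2v_curl].
Qed.

Lemma weak_div_lin a b w w' d d' : L2v Omega w -> L2v Omega w' ->
  L2 Omega d -> L2 Omega d' ->
  is_weak_div Omega w d -> is_weak_div Omega w' d' ->
  is_weak_div Omega (fun x => a *: w x + b *: w' x) (fun x => a * d x + b * d' x).
Proof.
move=> hw hw' hd hd' h h' phi tphi.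
rewrite ip_lin //; last exact: L2v_grad.
have lphi := L2_test tphi.
have i1 := L2_mul_integrable mO hd lphi; have i2 := L2_mul_integrable mO hd' lphi.
have := h _ tphi; have := h' _ tphi; move=> /(congr1 -%R); rewrite opprK => <-.
move=> /(congr1 -%R); rewrite opprK => <-.
rewrite !mulrN -opprD opprK -!RintegralZl // -RintegralD //.
- by apply: eq_Rintegral => x _; ring.
- exact: (integrableZl mO a i1).
- exact: (integrableZl mO b i2).
Qed.

Lemma weak_div_unique w d : L2 Omega d -> is_weak_div Omega w d ->
  (forall phi, test_fun Omega phi -> ip Omega w (grad phi) = 0) ->
  {ae mu, forall x, Omega x -> d x = 0}.
Proof.
move=> hd h h0; apply: test_fun_ae_eq0 => // phi tphi.
by rewrite h // h0 // oppr0.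
Qed.

Lemma ip_ae0 v w : L2v Omega v -> L2v Omega w ->
  {ae mu, forall x, Omega x -> v x = 0} -> ip Omega v w = 0.
Proof.
move=> hv hw v0; have iv := dot_integrable hv hw.
rewrite /ip /Rintegral (_ : (\int[mu]_(x in Omega) (dot (v x) (w x))%:E = 0)%E) //.
have <- : (\int[mu]_(x in Omega) (cst 0 x) = 0)%E by rewrite integral0.
apply: ae_eq_integral => //; first exact: measurable_int iv.
move: v0; apply: leb3_aeS => x h Ox.
by rewrite h // /dot big1 // => i _; rewrite mxE mul0r.
Qed.

Lemma ip_self_eq0 w : L2v Omega w -> ip Omega w w = 0 ->
  {ae mu, forall x, Omega x -> w x = 0}.
Proof.
move=> hw; have iw := dot_integrable hw hw.
have dot_ge0 (a : 'cV[R]_3) : 0 <= dot a a.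
  by apply: sumr_ge0 => i _; rewrite -expr2 sqr_ge0.
rewrite /ip /Rintegral => /eqP; rewrite fine_eq0; last exact: integrable_fin_num.
move=> /eqP i0.
have /(ae_eq_integral_abs _ mO (measurable_int mu iw)) : (\int[mu]_(x in Omega) `|(dot (w x) (w x))%:E| = 0)%E.
  by rewrite -[RHS]i0; apply: eq_integral => x _; rewrite gee0_abs ?lee_fin.
apply: leb3_aeS => x h' Ox.
have /eqP : dot (w x) (w x) = 0 by apply: EFin_inj; exact: h' Ox.
rewrite psumr_eq0 => [/allP h|i _]; last by rewrite -expr2 sqr_ge0.
apply/matrixP => i j; rewrite ord1 mxE.
by have := h i (mem_index_enum _); rewrite mulf_eq0 orbb => /eqP.
Qed.

End L2v.

(** * The weak curl of a piecewise polynomial field *)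

Section weak_curl_piece.
Context {R : realType}.
Local Notation mu := (@leb3 R).
Local Notation e_ i := (@Defs.basis R i).

Lemma partial0 i : partial i (fun=> 0 : R) = (fun=> 0).
Proof. by apply/funext => x; rewrite /partial derive_cst. Qed.

Lemma test_fun0 U : @test_fun R U (fun=> 0).
Proof.
split; last by exists set0; split => //; exact: compact0.
move=> s; have -> : foldr partial (fun=> 0 : R) s = (fun=> 0).
  by elim: s => //= i s ->; exact: partial0.
by split=> [x|i x]; [exact: cvg_cst|exact: derivable_cst].
Qed.

Lemma test_fun_subset (A B : set (pt3 R)) phi : A `<=` B -> test_fun A phi -> test_fun B phi.
Proof.
by move=> AB [s [C [cC CA C0]]]; split=> //; exists C; split=> // x /CA /AB.
Qed.

Lemma partialM i (f g : pt3 R -> R) x : derivable f x (e_ i) -> derivable g x (e_ i) ->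
  is_derive x (e_ i) (fun x => f x * g x) (f x * partial i g x + g x * partial i f x).
Proof. by move=> df dg; exact: is_deriveM (derivableP df) (derivableP dg). Qed.

(** Test fields with a single nonzero component isolate component [j] of the weak curl. *)
Definition unit_field (j : 'I_3) (phi : pt3 R -> R) : pt3 R -> 'cV[R]_3 :=
  fun x => phi x *: delta_mx j 0.

Lemma comp_unit_field i j phi :
  Defs.comp (unit_field j phi) i = if i == j then phi else (fun=> 0).
Proof.
apply/funext => x; rewrite /Defs.comp /unit_field !mxE andbT.
by case: eqP; rewrite ?mulr1 ?mulr0.
Qed.

Lemma dot_unit_field (a : 'cV[R]_3) j phi x : dot a (unit_field j phi x) = a j 0 * phi x.
Proof.
rewrite /dot (bigD1 j) //= big1 => [|i ij]; rewrite !mxE ?eqxx ?mulr1 ?addr0 //.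
by rewrite (negbTE ij) /= !mulr0.
Qed.

Lemma ord3_add : ((1 + 1 = 2 :> 'I_3)%R * (1 + 2 = 0 :> 'I_3)%R *
  (2 + 1 = 0 :> 'I_3)%R * (2 + 2 = 1 :> 'I_3)%R)%type.
Proof. by do ?split; apply: val_inj. Qed.

Lemma dot_curl_unit_field (a : 'cV[R]_3) j phi x : dot a (curl (unit_field j phi) x) =
  a (j + 1) 0 * partial (j + 2) phi x - a (j + 2) 0 * partial (j + 1) phi x.
Proof.
rewrite dotE !mxE !comp_unit_field.
elim/ord3_ind: j; rewrite ?add0r ?ord3_add ?eqxx ?ord3_neq ?partial0;
  move: (partial 0 phi x) (partial 1 phi x) (partial 2 phi x) => p0 p1 p2; ring.
Qed.

Lemma bounded_set_subset (A B : set (pt3 R)) : A `<=` B -> bounded_set B -> bounded_set A.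
Proof.
move=> AB [M [Mr HM]]; exists M; split => // M' MM' x Ax.
exact: HM (AB _ Ax).
Qed.

(** A test field supported in [K] is a test field on [Omega] as well, so the global weak curl
    identity restricts to [K]. There [v] may be replaced by [p], and integrating by parts against a
    field with compact support in [K] leaves no boundary term on the faces. *)
Lemma weak_curl_piece (Omega K : set (pt3 R)) (k : nat) (v w p : pt3 R -> 'cV[R]_3) :
  open Omega -> bounded_set Omega -> open K -> K `<=` Omega ->
  L2v Omega v -> L2v Omega w -> is_weak_curl Omega v w ->
  (forall i, C1poly k (Defs.comp p i)) ->
  {ae mu, forall x, K x -> v x = p x} ->
  {ae mu, forall x, K x -> w x = curl p x}.
Proof.
move=> oO bO oK KO hv hw vw hp vp.
have bK := bounded_set_subset KO bO.
have mO := open_measurable3 oO; have mK := open_measurable3 oK.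
have hvK : L2v K v by move=> i; exact: L2_subset (hv i).
have hwK : L2v K w by move=> i; exact: L2_subset (hw i).
have hpK : L2v K p.
  by move=> i; apply: (L2_continuous_bounded oK bK oK) => //; exact: (hp i).1.
have curlpC i : continuous (Defs.comp (curl p) i).
  by apply: (@Pk_continuous _ k); exact: C1poly_curl.
have hcK : L2v K (curl p) by move=> i; exact: (L2_continuous_bounded oK bK oK).
have piece j : {ae mu, forall x, K x -> Defs.comp w j x - Defs.comp (curl p) j x = 0}.
  apply: test_fun_ae_eq0 => //; first exact: bounded_lty.
    exact: L2_sub.
  move=> phi tphi; pose Phi := unit_field j phi.
  have tPhi : test_field K Phi.
    by move=> i; rewrite comp_unit_field; case: eqP => // _; exact: test_fun0.
  have L2phi := L2_test oK bK tphi.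
  have L2cPhi := L2v_curl oK bK tPhi.
  have [sphi [C [cC CK C0]]] := tphi.
  have out x : Omega x -> ~ K x -> phi x = 0 by move=> _ nK; apply: C0 => /CK.
  have dout x i : ~ K x -> partial i phi x = 0.
    move=> nK; apply: (@partial_eq0 _ phi i C) => [||/CK //]; last exact: C0.
    by apply: compact_closed cC; exact: norm_hausdorff.
  have E1 : ip Omega w Phi = \int[mu]_(x in K) (Defs.comp w j x * phi x).
    rewrite /ip (@Rintegral_support _ _ K) //.
      by apply: eq_Rintegral => x _; rewrite dot_unit_field.
    by move=> x Ox nK; rewrite dot_unit_field out // mulr0.
  have E2 : ip Omega v (curl Phi) = \int[mu]_(x in K) dot (p x) (curl Phi x).
    rewrite /ip (@Rintegral_support _ _ K) //; last first.
      by move=> x Ox nK; rewrite dot_curl_unit_field !dout // !mulr0 subrr.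
    congr fine; apply: ae_eq_integral => //.
    - exact: measurable_int (dot_integrable oK hvK L2cPhi).
    - exact: measurable_int (dot_integrable oK hpK L2cPhi).
    - by move: vp; apply: leb3_aeS => x h Kx; rewrite h.
  have E3 : \int[mu]_(x in K) (Defs.comp w j x * phi x) =
            \int[mu]_(x in K) dot (p x) (curl Phi x).
    rewrite -E1 -E2; apply: vw => i; exact: test_fun_subset (tPhi i).
  have i1 := L2_mul_integrable mK (hwK j) L2phi.
  have i2 := L2_mul_integrable mK (hcK j) L2phi.
  have i3 := dot_integrable oK hpK L2cPhi.
  transitivity (\int[mu]_(x in K) (Defs.comp w j x * phi x) -
                \int[mu]_(x in K) (Defs.comp (curl p) j x * phi x)).
    by rewrite -RintegralB //; apply: eq_Rintegral => x _; rewrite mulrBl.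
  rewrite E3 -RintegralB //.
  (* By the product rule, [p] dotted with the curl of [Phi], minus component [j] of [curl p] times
     [phi], equals the difference of two first derivatives of these products. *)
  pose psi i := fun x => Defs.comp p i x * phi x.
  have dpsi i l x : is_derive x (e_ l) (psi i)
      (Defs.comp p i x * partial l phi x + phi x * partial l (Defs.comp p i) x).
    by apply: partialM; [exact: ((hp i).2 l).1|exact: (sphi [::]).2].
  have ddpsi i l x : derivable (psi i) x (e_ l) by have [] := dpsi i l x.
  have dpsiE i l x : partial l (psi i) x =
      Defs.comp p i x * partial l phi x + phi x * partial l (Defs.comp p i) x.
    by have [_ <-] := dpsi i l x.
  have cpsi i l : continuous (partial l (psi i)).
    have -> : partial l (psi i) = fun x =>
        Defs.comp p i x * partial l phi x + phi x * partial l (Defs.comp p i) x.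
      by apply/funext => x; exact: dpsiE.
    move=> x; apply: cvgD; apply: cvgM.
    - exact: (hp i).1.
    - exact: (sphi [:: l]).1.
    - exact: (sphi [::]).1.
    - exact: (Pk_continuous ((hp i).2 l).2).
  have psiC i x : ~ C x -> psi i x = 0 by move=> nC; rewrite /psi C0 ?mulr0.
  have dpsiC i l x : ~ C x -> partial l (psi i) x = 0.
    apply: partial_eq0; last exact: psiC.
    by apply: compact_closed cC; exact: norm_hausdorff.
  have ii i l := compact_support_integrable cC (cpsi i l) (dpsiC i l).
  (* The products vanish outside the compact set [C] inside [K], so the integral over [K] extends to
     the whole space, where each derivative integrates to 0. *)
  transitivity (\int[mu]_x (partial (j + 2) (psi (j + 1)) x - partial (j + 1) (psi (j + 2)) x)).
    rewrite Rintegral_mkcond; apply: eq_Rintegral => x _; rewrite patchE.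
    case: ifPn => [/set_mem Kx|/negP nK]; last first.
      by rewrite !dpsiC ?subrr // => /CK Kx; apply: nK; exact/mem_set.
    rewrite dot_curl_unit_field /Defs.comp mxE.
    rewrite !dpsiE /Defs.comp.
    move: (partial _ _ x) (partial _ _ x) (partial _ _ x) (partial _ _ x) => d1 d2 d3 d4.
    by ring.
  rewrite RintegralB //; try exact: ii.
  by rewrite /Rintegral !(integral_partial0 cC (psiC _) (ddpsi _ _) (cpsi _ _)) subrr.
move: (leb3_aeI (piece 0) (leb3_aeI (piece 1) (piece 2))).
apply: leb3_aeS => x [h0 [h1 h2]] Kx; apply/matrixP => i l; rewrite ord1.
by apply/eqP; rewrite -subr_eq0; apply/eqP; elim/ord3_ind: i; [exact: h0|exact: h1|exact: h2].
Qed.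

End weak_curl_piece.

(** * The discrete system *)

Section assembly.
Context {R : realType}.
Local Notation mu := (@leb3 R).
Variables (Omega : set (pt3 R)) (k : nat) (T : set (set (pt3 R))).
Hypotheses (oO : open Omega) (bO : bounded_set Omega) (meshT : tetra_mesh Omega T).
Implicit Types (v w : pt3 R -> 'cV[R]_3) (u : pt3 R -> R).

Lemma Hcurl_wcurl v : Hcurl Omega v ->
  L2v Omega (wcurl Omega v) /\ is_weak_curl Omega v (wcurl Omega v).
Proof. by move=> [_ ex]; exact: (getPex ex). Qed.

Lemma Hdiv_wdiv w : Hdiv Omega w ->
  L2 Omega (wdiv Omega w) /\ is_weak_div Omega w (wdiv Omega w).
Proof. by move=> [_ ex]; exact: (getPex ex). Qed.

Lemma Hcurl_lin a b v w : Hcurl Omega v -> Hcurl Omega w ->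
  Hcurl Omega (fun x => a *: v x + b *: w x).
Proof.
move=> hv hw; have [lv cv] := Hcurl_wcurl hv; have [lw cw] := Hcurl_wcurl hw.
split; first by apply: L2v_lin; [exact: hv.1|exact: hw.1].
exists (fun x => a *: wcurl Omega v x + b *: wcurl Omega w x).
split; first exact: L2v_lin.
by apply: weak_curl_lin => //; [exact: hv.1|exact: hw.1].
Qed.

Lemma Hdiv_lin a b v w : Hdiv Omega v -> Hdiv Omega w ->
  Hdiv Omega (fun x => a *: v x + b *: w x).
Proof.
move=> hv hw; have [lv cv] := Hdiv_wdiv hv; have [lw cw] := Hdiv_wdiv hw.
split; first by apply: L2v_lin; [exact: hv.1|exact: hw.1].
exists (fun x => a * wdiv Omega v x + b * wdiv Omega w x).
split; first by apply: L2_add; apply: L2_scale.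
by apply: weak_div_lin => //; [exact: hv.1|exact: hw.1].
Qed.

Lemma L2_0 : L2 Omega (fun=> 0 : R).
Proof. by apply: (L2_continuous_bounded oO bO oO) => // x; exact: cvg_cst. Qed.

Lemma Hdiv_wcurl v : Hcurl Omega v -> Hdiv Omega (wcurl Omega v).
Proof.
move=> /Hcurl_wcurl[lw cw]; split=> //; exists (fun=> 0); split; first exact: L2_0.
exact: weak_div_weak_curl cw.
Qed.

Lemma raviart_thomas_lin a b v w : raviart_thomas k v -> raviart_thomas k w ->
  raviart_thomas k (fun x => a *: v x + b *: w x).
Proof.
move=> [p [q [hp hq hv]]] [p' [q' [hp' hq' hw]]].
exists (fun x => a *: p x + b *: p' x), (fun x => a * q x + b * q' x); split.
- move=> i; rewrite (_ : Defs.comp _ i = fun x => a * Defs.comp p i x + b * Defs.comp p' i x).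
    by apply: poly_of_degreeD; apply: poly_of_degreeZ; [exact: hp|exact: hp'].
  by apply/funext => x; rewrite /Defs.comp !mxE.
- by apply: poly_of_degreeD; apply: poly_of_degreeZ.
- move=> x; rewrite hv hw !scalerDr !scalerDl !scalerA -!addrA; congr (_ + _).
  by rewrite addrCA.
Qed.

Lemma RTh_lin a b v w : RTh Omega k T v -> RTh Omega k T w ->
  RTh Omega k T (fun x => a *: v x + b *: w x).
Proof.
move=> [hv pv] [hw pw]; split; first exact: Hdiv_lin.
move=> K TK; have [p hp vp] := pv K TK; have [q hq wq] := pw K TK.
exists (fun x => a *: p x + b *: q x); first exact: raviart_thomas_lin.
move: (leb3_aeI vp wq); apply: leb3_aeS => x [h h'] Kx.
by rewrite (h Kx) (h' Kx).
Qed.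

(** The H(div) part is global. On each element, differentiating a Nedelec polynomial of degree at
    most k + 1 lands in P_k, which is contained in the Raviart-Thomas space with zero homogeneous
    part. *)
Lemma RTh_wcurl_lin a b v w : Nh Omega k T v -> Nh Omega k T w ->
  RTh Omega k T (wcurl Omega (fun x => a *: v x + b *: w x)).
Proof.
move=> [hv pv] [hw pw]; have hvw := Hcurl_lin a b hv hw.
split; first exact: Hdiv_wcurl.
have [lc wc] := Hcurl_wcurl hvw.
move=> K TK; have [p hp vp] := pv K TK; have [q hq wq] := pw K TK.
have [_ tetra KO _ _] := meshT; have [t ht Kt] := tetra K TK.
have C1 i : C1poly k (Defs.comp (fun x => a *: p x + b *: q x) i).
  rewrite (_ : Defs.comp _ i = fun x => a * Defs.comp p i x + b * Defs.comp q i x).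
    by apply: C1poly_add; apply: C1poly_scale; exact: nedelec_C1poly.
  by apply/funext => x; rewrite /Defs.comp !mxE.
exists (curl (fun x => a *: p x + b *: q x)).
  by apply: raviart_thomas_Pk => i; exact: C1poly_curl.
apply: (weak_curl_piece oO bO _ (KO K TK) hvw.1 lc wc C1).
  by rewrite Kt; exact: open_open_tetra.
move: (leb3_aeI vp wq); apply: leb3_aeS => x [h h'] Kx.
by rewrite (h Kx) (h' Kx).
Qed.

Lemma eq_Qh0 u : L2 Omega u -> {ae mu, forall x, Omega x -> u x = 0} ->
  eq_Qh Omega k T u (fun=> 0).
Proof.
have [_ _ KO _ _] := meshT.
move=> lu u0; split => //; split => //; try exact: L2_0.
- move=> K TK; exists (fun=> 0); first exact: Pk0.
  by move: u0; apply: leb3_aeS => x h Kx; apply: h; exact: KO Kx.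
- by move=> K TK; exists (fun=> 0); [exact: Pk0|exact: aeW].
Qed.

(** One time step. The difference quotient of the chosen divergences need not be the chosen
    divergence of [delta_t dt B n], but it is one of its weak divergences, which is enough for
    uniqueness a.e. *)
Lemma discrete_step dt (E B : nat -> pt3 R -> 'cV[R]_3) n : dt != 0 ->
  Nh Omega k T (E n) -> Nh Omega k T (E n.+1) ->
  RTh Omega k T (B n) -> RTh Omega k T (B n.+1) ->
  (forall phi, RTh Omega k T phi ->
     ip Omega (delta_t dt B n) phi + ip Omega (wcurl Omega (midpoint E n)) phi = 0) ->
  let divB := fun n => wdiv Omega (B n) in
  [/\ RTh Omega k T (wcurl Omega (midpoint E n)),
    L2 Omega (delta_t dt divB n),
    {ae mu, forall x, Omega x -> delta_t dt divB n x = 0},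
    L2 Omega (wdiv Omega (wcurl Omega (midpoint E n))) &
    {ae mu, forall x, Omega x -> wdiv Omega (wcurl Omega (midpoint E n)) x = 0}].
Proof.
move=> dt0 E0 E1 B0 B1 H divB.
have mE : midpoint E n = fun x => 2^-1 *: E n.+1 x + 2^-1 *: E n x.
  by apply/funext => x; rewrite /midpoint scalerDr.
have dB : delta_t dt B n = fun x => dt^-1 *: B n.+1 x + (- dt^-1) *: B n x.
  by apply/funext => x; rewrite /delta_t scalerBr scaleNr.
have ddivB : delta_t dt divB n = fun x => dt^-1 * divB n.+1 x + (- dt^-1) * divB n x.
  by apply/funext => x; rewrite /delta_t scalerBr mulNr.
set w := wcurl Omega (midpoint E n) in H *.
have RTw : RTh Omega k T w by rewrite /w mE; exact: RTh_wcurl_lin.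
have RTdB : RTh Omega k T (delta_t dt B n) by rewrite dB; exact: RTh_lin.
have [Lw Hw] := RTw.1; have [LdB _] := RTdB.1.
have ww : is_weak_div Omega w (fun=> 0).
  apply: (weak_div_weak_curl (v := midpoint E n)).
  apply: (Hcurl_wcurl _).2; rewrite mE; apply: Hcurl_lin; [exact: E1.1|exact: E0.1].
have w0 phi : test_fun Omega phi -> ip Omega w (grad phi) = 0.
  move=> /ww /(congr1 -%R); rewrite opprK => <-.
  by under eq_Rintegral do rewrite mul0r; rewrite /Rintegral integral0 /= oppr0.
(* The coefficients 1 put the sum in the shape of the two-coefficient lemmas. *)
have ip_add z : L2v Omega z -> ip Omega (fun x => 1 *: delta_t dt B n x + 1 *: w x) z =
    ip Omega (delta_t dt B n) z + ip Omega w z.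
  by move=> Lz; rewrite ip_lin // !mul1r.
have RTs : RTh Omega k T (fun x => 1 *: delta_t dt B n x + 1 *: w x) by exact: RTh_lin.
have s0 : {ae mu, forall x, Omega x -> 1 *: delta_t dt B n x + 1 *: w x = 0}.
  apply: (ip_self_eq0 oO RTs.1.1).
  by rewrite ip_add ?H //; exact: RTs.1.1.
(* Against a gradient [w] contributes 0, so [delta_t dt B n] can be replaced by the sum, which
   vanishes a.e. *)
have dB0 phi : test_fun Omega phi -> ip Omega (delta_t dt B n) (grad phi) = 0.
  move=> tphi; have Lg := L2v_grad oO bO tphi.
  have := ip_add _ Lg; rewrite w0 // addr0 => <-.
  exact: (ip_ae0 oO RTs.1.1 Lg s0).
have [LB1 WB1] := Hdiv_wdiv B1.1; have [LB0 WB0] := Hdiv_wdiv B0.1.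
have LddivB : L2 Omega (delta_t dt divB n).
  by rewrite ddivB; exact: (L2_add (L2_scale dt^-1 LB1) (L2_scale (- dt^-1) LB0)).
have [Lww Www] := Hdiv_wdiv RTw.1.
split => //.
- apply: (weak_div_unique oO bO LddivB _ dB0); rewrite ddivB dB.
  exact: (weak_div_lin oO bO dt^-1 (- dt^-1) B1.1.1 B0.1.1 LB1 LB0 WB1 WB0).
- exact: (weak_div_unique oO bO Lww Www w0).
Qed.

End assembly.

Theorem lemma2 (R : realType) (Omega : set (pt3 R)) (Tf : R)
    (eps mu sigma : pt3 R -> 'M[R]_3) (f : R -> pt3 R -> 'cV[R]_3)
    (H : Type) (Th : H -> set (set (pt3 R))) (k : nat)
    (Omega_lip : bounded_lipschitz_domain Omega) (Tf_gt0 : 0 < Tf)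
    (eps_Linf : Linf_tensor Omega eps) (mu_Linf : Linf_tensor Omega mu)
    (sigma_Linf : Linf_tensor Omega sigma)
    (eps_sym : symmetric_tensor Omega eps) (mu_sym : symmetric_tensor Omega mu)
    (sigma_sym : symmetric_tensor Omega sigma)
    (eps_pd : uniformly_posdef Omega eps) (mu_pd : uniformly_posdef Omega mu)
    (sigma_psd : possemidef Omega sigma)
    (f_L2 : L2_time_space Tf Omega f)
    (Th_mesh : forall h, tetra_mesh Omega (Th h)) (Th_reg : shape_regular Th)
    (h : H) (Nt : nat) (Nt_gt0 : (0 < Nt)%N)
    (E B : nat -> pt3 R -> 'cV[R]_3) :
  let dt := Tf / Nt%:R in
  let divB := fun n => wdiv Omega (B n) in
  discrete_solution Omega k (Th h) eps mu sigma f dt Nt E B ->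
  [/\ forall n, (n < Nt)%N ->
        RTh Omega k (Th h) (wcurl Omega (midpoint E n)) /\
        eq_Qh Omega k (Th h)
          (fun x => delta_t dt divB n x
                    + wdiv Omega (wcurl Omega (midpoint E n)) x)
          (fun=> 0),
      forall n, (n < Nt)%N ->
        eq_Qh Omega k (Th h) (delta_t dt divB n) (fun=> 0) &
      eq_Qh Omega k (Th h) (divB 0%N) (fun=> 0) ->
      forall n, (n <= Nt)%N -> eq_Qh Omega k (Th h) (divB n) (fun=> 0)].

Proof.
move=> dt divB [ENh BRT sys].
have [_ oO _ bO _] := Omega_lip; have mesh := Th_mesh h.
have dt0 : dt != 0 by rewrite mulf_neq0 ?invr_eq0 ?gt_eqF ?ltr0n.
have step n : (n < Nt)%N -> _ := fun nN => discrete_step oO bO mesh dt0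
  (ENh n (ltnW nN)).1 (ENh n.+1 nN).1 (BRT n (ltnW nN)) (BRT n.+1 nN) (sys n nN).2.
split.
- move=> n nN; have [RTw LB B0 Lw w0] := step n nN; split=> //.
  apply: eq_Qh0 => //; first exact: L2_add LB Lw.
  move: (leb3_aeI B0 w0); apply: leb3_aeS => x [h1 h2] Ox.
  by rewrite (h1 Ox) (h2 Ox) addr0.
- by move=> n nN; have [_ LB B0 _ _] := step n nN; exact: eq_Qh0.
- move=> [_ _ B00] n nN.
  (* Square integrability holds for each [n] separately, since [B n] is in H(div); only the equality
     a.e. is propagated by induction, each step adding one null set. *)
  apply: (eq_Qh0 k oO bO mesh (Hdiv_wdiv (BRT n nN).1).1).
  elim: n nN => [_|n IH nN]; first exact: B00.
  have [_ _ B0 _ _] := step n nN.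
  move: (leb3_aeI (IH (ltnW nN)) B0); apply: leb3_aeS => x [h1 h2] Ox.
  have /eqP := h2 Ox; rewrite /delta_t scaler_eq0 invr_eq0 (negbTE dt0) /= subr_eq0.
  by move=> /eqP E1; exact: etrans E1 (h1 Ox).
Qed.
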